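(* Let $\alpha_0,\dots,\alpha_6$ be complex parameters with $\alpha_0+\alpha_1+2\alpha_2+2\alpha_3+2\alpha_4+\alpha_5+\alpha_6=1$, and consider the Hamiltonian system $$dq_i=\frac{\partial H_1}{\partial p_i}dt+\frac{\partial H_2}{\partial p_i}ds,\qquad dp_i=-\frac{\partial H_1}{\partial q_i}dt-\frac{\partial H_2}{\partial q_i}ds\qquad(i=1,2)$$ with the Hamiltonians $H_1,H_2$ given in the context. This system admits affine Weyl group symmetry of type $D_6^{(1)}$ as a group of B\''acklund transformations, with generators $s_0,\dots,s_6$, together with $\pi_1,\pi_2,\pi_3$: each of the following birational transformations, with $( * ):=(q_1,p_1,q_2,p_2,t,s;\alpha_0,\dots,\alpha_6)$, leaves the system invariant, and $s_0,\dots,s_6$ generate the affine Weyl group of type $D_6^{(1)}$. $$\begin{aligned} s_0:( * )\to&\left(q_1,p_1-\tfrac{\alpha_0}{q_1-t},q_2,p_2,t,s;-\alpha_0,\alpha_1,\alpha_2+\alpha_0,\alpha_3,\alpha_4,\alpha_5,\alpha_6\right),\\ s_1:( * )\to&\left(q_1,p_1-\tfrac{\alpha_1}{q_1-s},q_2,p_2,t,s;\alpha_0,-\alpha_1,\alpha_2+\alpha_1,\alpha_3,\alpha_4,\alpha_5,\alpha_6\right),\\ s_2:( * )\to&\left(q_1+\tfrac{\alpha_2}{p_1},p_1,q_2,p_2,t,s;\alpha_0+\alpha_2,\alpha_1+\alpha_2,-\alpha_2,\alpha_3+\alpha_2,\alpha_4,\alpha_5,\alpha_6\right),\\ s_3:(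 * )\to&\left(q_1,p_1-\tfrac{\alpha_3}{q_1-q_2},q_2,p_2+\tfrac{\alpha_3}{q_1-q_2},t,s;\alpha_0,\alpha_1,\alpha_2+\alpha_3,-\alpha_3,\alpha_4+\alpha_3,\alpha_5,\alpha_6\right),\\ s_4:( * )\to&\left(q_1,p_1,q_2+\tfrac{\alpha_4}{p_2},p_2,t,s;\alpha_0,\alpha_1,\alpha_2,\alpha_3+\alpha_4,-\alpha_4,\alpha_5+\alpha_4,\alpha_6+\alpha_4\right),\\ s_5:( * )\to&\left(q_1,p_1,q_2,p_2-\tfrac{\alpha_5}{q_2-1},t,s;\alpha_0,\alpha_1,\alpha_2,\alpha_3,\alpha_4+\alpha_5,-\alpha_5,\alpha_6\right),\\ s_6:( * )\to&\left(q_1,p_1,q_2,p_2-\tfrac{\alpha_6}{q_2},t,s;\alpha_0,\alpha_1,\alpha_2,\alpha_3,\alpha_4+\alpha_6,\alpha_5,-\alpha_6\right),\\ \pi_1:( * )\to&\Big(\tfrac{(t-1)q_1}{t-q_1-ts+tsq_1},\tfrac{(-t+q_1+ts-tsq_1)(tp_1-q_1p_1-\alpha_2-tsp_1+tsq_1p_1+\alpha_2ts)}{t(t-1)(s-1)},\\ &\ \tfrac{(t-1)q_2}{t-q_2-ts+tsq_2},\tfrac{(-t+q_2+ts-tsq_2)(tp_2-q_2p_2-\alpha_4-tsp_2+tsq_2p_2+\alpha_4ts)}{t(t-1)(s-1)},\\ &\ \tfrac{s(t-1)}{t-s-ts+ts^2},\tfrac1s;\alpha_1,\alpha_0,\alpha_2,\alpha_3,\alpha_4,\alpha_5,\alpha_6\Big),\\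 \pi_2:( * )\to&(1-q_1,-p_1,1-q_2,-p_2,1-t,1-s;\alpha_0,\alpha_1,\alpha_2,\alpha_3,\alpha_4,\alpha_6,\alpha_5),\\ \pi_3:( * )\to&\Big(\tfrac{t(q_2-s)}{t(q_2-s)+s^2(t-q_2)},\tfrac{(t(q_2-s)+s^2(t-q_2))(t(q_2-s)p_2+\alpha_4(t-s^2)+s^2(t-q_2)p_2)}{ts^2(t-s)},\\ &\ \tfrac{t(q_1-s)}{t(q_1-s)+s^2(t-q_1)},\tfrac{(t(q_1-s)+s^2(t-q_1))(t(q_1-s)p_1+\alpha_2(t-s^2)+s^2(t-q_1)p_1)}{ts^2(t-s)},\\ &\ -\tfrac{(s-1)t}{t-ts+s^2(t-1)},-\tfrac1{s-1};\alpha_5,\alpha_6,\alpha_4,\alpha_3,\alpha_2,\alpha_0,\alpha_1\Big). \end{aligned}$$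
   Context: The Hamiltonians are $$\begin{aligned}H_1=&\,H_{VI}(q_1,p_1,t,s;\alpha_0,\alpha_1,\alpha_2,\alpha_3+2\alpha_4+\alpha_5,\alpha_3+\alpha_6)\\&+H_{VI}(q_2,p_2,t,s;\alpha_0+2\alpha_2+\alpha_3,\alpha_1+\alpha_3,\alpha_4,\alpha_5,\alpha_6)\\&+\frac{2(q_1-s)q_2\{(q_1-t)p_1+\alpha_2\}\{(q_2-1)p_2+\alpha_4\}}{(\alpha_0+\alpha_1+2\alpha_2+2\alpha_3+2\alpha_4+\alpha_5+\alpha_6)\,t(t-1)(t-s)},\end{aligned}$$ and $H_2=\pi(H_1)$, where $\pi$ is the substitution exchanging $t\leftrightarrow s$ and $\alpha_0\leftrightarrow\alpha_1$. Here $$\begin{aligned}&t(t-1)(t-\eta)H_{VI}(q,p,t,\eta;\beta_0,\dots,\beta_4)\\&=q(q-1)(q-\eta)(q-t)p^2+\{\beta_1(t-\eta)q(q-1)+2\beta_2q(q-1)(q-\eta)+\beta_3(t-1)q(q-\eta)+\beta_4t(q-1)(q-\eta)\}p\\&\quad+\beta_2\{(\beta_1+\beta_2)(t-\eta)+\beta_2(q-1)+\beta_3(t-1)+t\beta_4\}q,\qquad \beta_0+\beta_1+2\beta_2+\beta_3+\beta_4=1.\end{aligned}$$ A transformation $(q_1,p_1,q_2,p_2,t,s;\alpha)\to(Q_1,P_1,Q_2,P_2,T,S;\alpha')$ leaves the system invariant (is a B\''acklund transformation) if it carries the system with parameters $\alpha$ to the system of the same form in the variables $(Q_1,P_1,Q_2,P_2)$,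 independent variables $(T,S)$ and parameters $\alpha'$. The Dynkin diagram of type $D_6^{(1)}$ has nodes $0,\dots,6$ with edges $0-2$, $1-2$, $2-3$, $3-4$, $4-5$, $4-6$; its affine Weyl group has generators $s_i$ and relations $s_i^2=1$, $(s_is_j)^2=1$ for non-adjacent $i\ne j$, $(s_is_j)^3=1$ for adjacent $i,j$. *)

(* Defs.v *)
From HB Require Import structures.
From mathcomp Require Import all_boot all_algebra.
From mathcomp Require Import fraction generic_quotient.
From mathcomp Require Import complex reals mpoly.

Set Implicit Arguments.
Unset Strict Implicit.
Unset Printing Implicit Defensive.

Import GRing.Theory.
Local Open Scope ring_scope.

(* The normalisation is b0 + b1 + 2 b2 + b3 + b4 = 1; b0 does not occur in    *)
(* the formula.                                                               *)
Definition HVI (F : fieldType) (q p t eta b0 b1 b2 b3 b4 : F) : F :=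
  (q * (q - 1) * (q - eta) * (q - t) * p ^+ 2
   + (b1 * (t - eta) * q * (q - 1) + 2 * b2 * q * (q - 1) * (q - eta)
      + b3 * (t - 1) * q * (q - eta) + b4 * t * (q - 1) * (q - eta)) * p
   + b2 * ((b1 + b2) * (t - eta) + b2 * (q - 1) + b3 * (t - 1) + t * b4) * q)
  / (t * (t - 1) * (t - eta)).

Definition H1 (F : fieldType) (q1 p1 q2 p2 t s a0 a1 a2 a3 a4 a5 a6 : F) : F :=
  HVI q1 p1 t s a0 a1 a2 (a3 + 2 * a4 + a5) (a3 + a6)
  + HVI q2 p2 t s (a0 + 2 * a2 + a3) (a1 + a3) a4 a5 a6
  + 2 * (q1 - s) * q2 * ((q1 - t) * p1 + a2) * ((q2 - 1) * p2 + a4)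
    / ((a0 + a1 + 2 * a2 + 2 * a3 + 2 * a4 + a5 + a6) * t * (t - 1) * (t - s)).

Definition H2 (F : fieldType) (q1 p1 q2 p2 t s a0 a1 a2 a3 a4 a5 a6 : F) : F :=
  H1 q1 p1 q2 p2 s t a1 a0 a2 a3 a4 a5 a6.

(* The field of rational functions in q1, p1, q2, p2, t, s (in this order).   *)
Notation ratfun C := {fraction {mpoly C[6]}}.

Section RationalFunctions.
Variable C : fieldType.
Local Notation K := (ratfun C).

Definition cst (c : C) : K := tofrac (c%:MP_[6]).

Definition coordinate (k : nat) : K := tofrac 'X_(inord k : 'I_6).

Definition q1 := coordinate 0.
Definition p1 := coordinate 1.
Definition q2 := coordinate 2.
Definition p2 := coordinate 3.
Definition t := coordinate 4.
Definition s := coordinate 5.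

(* Quotient rule applied to a representative of f; the value does not depend  *)
(* on it.                                                                     *)
Definition partial (i : 'I_6) (f : K) : K :=
  let n := \n_(repr f) in let d := \d_(repr f) in
  tofrac (mderiv i n * d - n * mderiv i d) / tofrac (d ^+ 2).

(* subst F f is the composite f o F, i.e. f with the six coordinates replaced *)
(* by the entries of F. It is independent of the chosen representative as     *)
(* soon as the entries of F are algebraically independent over C, i.e. F is   *)
(* dominant, which holds for every birational F.                              *)
Definition subst (F : 6.-tuple K) (f : K) : K :=
  mmap cst (tnth F) \n_(repr f) / mmap cst (tnth F) \d_(repr f).

(* A 1-form is the row of its coefficients on dq1, dp1, dq2, dp2, dt, ds.     *)
Definition dform (f : K) : 'rV[K]_6 := \row_i partial i f.

(* Pullback of a family of 1-forms (the rows of w) by a rational map F.       *)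
Definition pullback (m : nat) (F : 6.-tuple K) (w : 'M[K]_(m, 6)) :
    'M[K]_(m, 6) :=
  map_mx (subst F) w *m \matrix_(j < 6) dform (tnth F j).

End RationalFunctions.

Arguments q1 {C}.
Arguments p1 {C}.
Arguments q2 {C}.
Arguments p2 {C}.
Arguments t {C}.
Arguments s {C}.

Section System.
Variable C : fieldType.

Local Notation K := (ratfun C).
Local Notation params := (7.-tuple C).

Definition normalized (al : params) : Prop :=
  al`_0 + al`_1 + 2 * al`_2 + 2 * al`_3 + 2 * al`_4 + al`_5 + al`_6 = 1.

Definition ham1 (al : params) : K :=
  H1 q1 p1 q2 p2 t s (cst al`_0) (cst al`_1) (cst al`_2) (cst al`_3)
     (cst al`_4) (cst al`_5) (cst al`_6).

Definition ham2 (al : params) : K :=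
  H2 q1 p1 q2 p2 t s (cst al`_0) (cst al`_1) (cst al`_2) (cst al`_3)
     (cst al`_4) (cst al`_5) (cst al`_6).

Definition d_q1 : K -> K := partial (inord 0).
Definition d_p1 : K -> K := partial (inord 1).
Definition d_q2 : K -> K := partial (inord 2).
Definition d_p2 : K -> K := partial (inord 3).

(* The Hamiltonian system, as the Pfaffian system spanned by the four 1-forms *)
(*   dq_i - (dH1/dp_i) dt - (dH2/dp_i) ds,                                    *)
(*   dp_i + (dH1/dq_i) dt + (dH2/dq_i) ds          (i = 1, 2).                *)
Definition system (al : params) : 'M[K]_(4, 6) :=
  \matrix_(r < 4) tnth [tuple
    dform q1 - d_p1 (ham1 al) *: dform t - d_p1 (ham2 al) *: dform s;
    dform p1 + d_q1 (ham1 al) *: dform t + d_q1 (ham2 al) *: dform s;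
    dform q2 - d_p2 (ham1 al) *: dform t - d_p2 (ham2 al) *: dform s;
    dform p2 + d_q2 (ham1 al) *: dform t + d_q2 (ham2 al) *: dform s] r.

(* (q1, p1, q2, p2, t, s; al) |-> (Q1, P1, Q2, P2, T, S; al'): for each value *)
(* of the parameters, a rational map in the six variables and new parameters. *)
Definition transf := params -> 6.-tuple K * params.

(* Equality of transformations over the hyperplane of normalized parameters.  *)
Definition eqt (f g : transf) : Prop :=
  forall al, normalized al -> f al = g al.

Definition idt : transf := fun al => ([tuple q1; p1; q2; p2; t; s], al).

(* f followed by g *)
Definition compt (f g : transf) : transf := fun al =>
  let: (F, be) := f al in
  let: (G, ga) := g be in
  (map_tuple (subst F) G, ga).

Definition composite (fs : seq transf) : transf := foldr compt idt fs.

Definition preserves_normalization (f : transf) : Prop :=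
  forall al, normalized al -> normalized (f al).2.

Definition birational (f : transf) : Prop :=
  preserves_normalization f /\
  exists g : transf,
    [/\ preserves_normalization g, eqt (compt f g) idt & eqt (compt g f) idt].

(* f carries the system with parameters al to the one with parameters al':    *)
(* the pullback of the latter spans the same space of 1-forms as the former.  *)
Definition leaves_system_invariant (f : transf) : Prop :=
  forall al, normalized al ->
    (pullback (f al).1 (system (f al).2) == system al)%MS.

Definition backlund (f : transf) : Prop :=
  birational f /\ leaves_system_invariant f.

Definition with_params
    (f : C -> C -> C -> C -> C -> C -> C -> 6.-tuple K * params) : transf :=
  fun al => f al`_0 al`_1 al`_2 al`_3 al`_4 al`_5 al`_6.

Definition s0 : transf := with_params (fun a0 a1 a2 a3 a4 a5 a6 =>
  ([tuple q1; p1 - cst a0 / (q1 - t); q2; p2; t; s],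
   [tuple - a0; a1; a2 + a0; a3; a4; a5; a6])).

Definition s1 : transf := with_params (fun a0 a1 a2 a3 a4 a5 a6 =>
  ([tuple q1; p1 - cst a1 / (q1 - s); q2; p2; t; s],
   [tuple a0; - a1; a2 + a1; a3; a4; a5; a6])).

Definition s2 : transf := with_params (fun a0 a1 a2 a3 a4 a5 a6 =>
  ([tuple q1 + cst a2 / p1; p1; q2; p2; t; s],
   [tuple a0 + a2; a1 + a2; - a2; a3 + a2; a4; a5; a6])).

Definition s3 : transf := with_params (fun a0 a1 a2 a3 a4 a5 a6 =>
  ([tuple q1; p1 - cst a3 / (q1 - q2); q2; p2 + cst a3 / (q1 - q2); t; s],
   [tuple a0; a1; a2 + a3; - a3; a4 + a3; a5; a6])).

Definition s4 : transf := with_params (fun a0 a1 a2 a3 a4 a5 a6 =>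
  ([tuple q1; p1; q2 + cst a4 / p2; p2; t; s],
   [tuple a0; a1; a2; a3 + a4; - a4; a5 + a4; a6 + a4])).

Definition s5 : transf := with_params (fun a0 a1 a2 a3 a4 a5 a6 =>
  ([tuple q1; p1; q2; p2 - cst a5 / (q2 - 1); t; s],
   [tuple a0; a1; a2; a3; a4 + a5; - a5; a6])).

Definition s6 : transf := with_params (fun a0 a1 a2 a3 a4 a5 a6 =>
  ([tuple q1; p1; q2; p2 - cst a6 / q2; t; s],
   [tuple a0; a1; a2; a3; a4 + a6; a5; - a6])).

Definition pi1 : transf := with_params (fun a0 a1 a2 a3 a4 a5 a6 =>
  let Q (q : K) := (t - 1) * q / (t - q - t * s + t * s * q) in
  let P (q p a : K) :=
    (- t + q + t * s - t * s * q)
    * (t * p - q * p - a - t * s * p + t * s * q * p + a * t * s)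
    / (t * (t - 1) * (s - 1)) in
  ([tuple Q q1; P q1 p1 (cst a2); Q q2; P q2 p2 (cst a4);
          s * (t - 1) / (t - s - t * s + t * s ^+ 2); 1 / s],
   [tuple a1; a0; a2; a3; a4; a5; a6])).

Definition pi2 : transf := with_params (fun a0 a1 a2 a3 a4 a5 a6 =>
  ([tuple 1 - q1; - p1; 1 - q2; - p2; 1 - t; 1 - s],
   [tuple a0; a1; a2; a3; a4; a6; a5])).

Definition pi3 : transf := with_params (fun a0 a1 a2 a3 a4 a5 a6 =>
  let D (q : K) := t * (q - s) + s ^+ 2 * (t - q) in
  let Q (q : K) := t * (q - s) / D q in
  let P (q p a : K) :=
    D q * (t * (q - s) * p + a * (t - s ^+ 2) + s ^+ 2 * (t - q) * p)
    / (t * s ^+ 2 * (t - s)) in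
  ([tuple Q q2; P q2 p2 (cst a4); Q q1; P q1 p1 (cst a2);
          - ((s - 1) * t / (t - t * s + s ^+ 2 * (t - 1))); - (1 / (s - 1))],
   [tuple a5; a6; a4; a3; a2; a0; a1])).

Definition sgen (i : 'I_7) : transf := tnth [tuple s0; s1; s2; s3; s4; s5; s6] i.

Definition pigen (j : 'I_3) : transf := tnth [tuple pi1; pi2; pi3] j.

Definition gen (x : 'I_7 + 'I_3) : transf :=
  match x with inl i => sgen i | inr j => pigen j end.

End System.

Arguments sgen : clear implicits.
Arguments pigen : clear implicits.
Arguments gen : clear implicits.

Definition D6edges : seq (nat * nat) :=
  [:: (0, 2); (1, 2); (2, 3); (3, 4); (4, 5); (4, 6)]%N.

Definition adjacent (i j : 'I_7) : bool :=
  ((i : nat, j : nat) \in D6edges) || ((j : nat, i : nat) \in D6edges).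

(* Equality in the affine Weyl group of type D_6^(1): words in the generators *)
(* modulo the congruence generated by the defining relations. The relations   *)
(* s_i^2 = 1 provide the inverses.                                            *)
Inductive weyl_eq : seq 'I_7 -> seq 'I_7 -> Prop :=
| weyl_refl w : weyl_eq w w
| weyl_sym v w : weyl_eq v w -> weyl_eq w v
| weyl_trans u v w : weyl_eq u v -> weyl_eq v w -> weyl_eq u w
| weyl_ctx x y v w : weyl_eq v w -> weyl_eq (x ++ v ++ y) (x ++ w ++ y)
| weyl_square i : weyl_eq [:: i; i] [::]
| weyl_commute i j : i != j -> ~~ adjacent i j -> weyl_eq [:: i; j; i; j] [::]
| weyl_braid i j : adjacent i j -> weyl_eq [:: i; j; i; j; i; j] [::].

(* Main.v *)
Require Import Defs.
From HB Require Import structures.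
From mathcomp Require Import all_boot all_order all_algebra.
From mathcomp Require Import complex reals.
From mathcomp Require Import fraction mpoly ring zify.

Set Implicit Arguments.
Unset Strict Implicit.
Unset Printing Implicit Defensive.

Import Order.TTheory GRing.Theory Num.Theory.
Local Open Scope ring_scope.

(** Why the theorem holds.

    Invariance of the system is invariance of its set of solutions. A solution
    is a point x of K^6 together with a derivation D of a field K such that D x
    follows the Hamiltonian vector fields: the relation flow. Over the field of
    rational functions the generic point is a solution for two derivations,
    d/dt and d/ds along the two Hamiltonian vector fields, and these two vector
    fields span the common kernel of the four 1-forms of the system. Hence a
    map that sends solutions to solutions pulls the system back into itself
    (pullback_system); the reverse inclusion comes from the inverse map.

    That the generators send solutions to solutions is a rational identity for
    each of a few elementary maps. The map s_k is a shear: it moves a point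
    along a constant direction by a_k divided by an affine function, the mirror
    of k (flow_shear). The maps pi_j are made of three kinds of changes of
    q1, q2 by a Moebius transformation, which acts in the same way on the
    singular points 0, 1, t, s: the flip q -> 1 - q, the affine turn, which
    takes t, s to 1, 0, and the gauge transformations q -> q / ((1 - e) q + e),
    which fix 0 and 1 and preserve solutions for an arbitrary function e
    (flow_gauge). Then pi2 is the flip, pi1 is a gauge transformation after the
    exchange of t and s, and pi3 is a gauge transformation after the turn. The
    exchange preserves solutions because it defines the second Hamiltonian.

    The Coxeter relations hold because moving along the direction of i changes
    the mirror of j by 0 or by plus or minus the distance travelled, according
    to adjacency; what remains is one identity in two variables
    (braid_coefficients).

    Conversely, a word in s_0, ..., s_6 acts on the parameters by the transpose
    of its action on the root lattice by reflections. If two words give the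
    same transformation, they act in the same way on the root lattice, and
    then they are equal in the Coxeter group by the argument of Tits: a word
    w either sends the simple root of i to a positive vector, or w s_i is equal
    to a word shorter than w (positive_or_shorter). *)

(** * Evaluation of fractions along a ring morphism *)

Section Value.
Variables (R : idomainType) (L : fieldType) (phi : {rmorphism R -> L}).
Implicit Types (f g : {fraction R}) (v w : L).

(** The partial extension of phi to fractions, as a relation: a fraction has a
    value when some representative has a denominator that phi does not kill. *)
Definition value f v : Prop :=
  exists n d, [/\ phi d != 0, f * tofrac d = tofrac n & v * phi d = phi n].

Lemma value_tofrac r : value (tofrac r) (phi r).
Proof. by exists r, 1; rewrite !rmorph1 oner_neq0 !mulr1. Qed.

Lemma valueD f g v w : value f v -> value g w -> value (f + g) (v + w).
Proof.
move=> [n [d [d0 fE vE]]] [n' [d' [d0' gE wE]]].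
exists (n * d' + n' * d), (d * d'); rewrite !(rmorphD, rmorphM) /=.
by rewrite mulf_neq0 // -fE -gE -vE -wE; split=> //; ring.
Qed.

Lemma valueM f g v w : value f v -> value g w -> value (f * g) (v * w).
Proof.
move=> [n [d [d0 fE vE]]] [n' [d' [d0' gE wE]]].
exists (n * n'), (d * d'); rewrite !rmorphM /=.
by rewrite mulf_neq0 // -fE -gE -vE -wE; split=> //; ring.
Qed.

Lemma valueN f v : value f v -> value (- f) (- v).
Proof.
move=> [n [d [d0 fE vE]]]; exists (- n), d.
by rewrite !rmorphN /= !mulNr fE vE.
Qed.

Lemma valueB f g v w : value f v -> value g w -> value (f - g) (v - w).
Proof. by move=> fv gw; apply/valueD/valueN. Qed.

Lemma valueV f v : value f v -> v != 0 -> value f^-1 v^-1.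
Proof.
move=> [n [d [d0 fE vE]]] v0; exists d, n.
have n0 : phi n != 0 by rewrite -vE mulf_neq0.
have f0 : f != 0.
  apply: contraNneq n0 => f0; move/eqP: fE.
  by rewrite f0 mul0r eq_sym tofrac_eq0 => /eqP->; rewrite rmorph0.
by rewrite n0 -fE -vE !mulKf.
Qed.

Lemma valueX f v k : value f v -> value (f ^+ k) (v ^+ k).
Proof.
move=> fv; elim: k => [|k IHk]; last by rewrite !exprS; apply: valueM.
by rewrite !expr0 -(rmorph1 phi) -(rmorph1 (@tofrac R)); apply: value_tofrac.
Qed.

Lemma value1 : value 1 1.
Proof. exact: (valueX 0 (value_tofrac 0)). Qed.

Lemma value_nat k : value k%:R k%:R.
Proof. by rewrite -(rmorph_nat phi) -(rmorph_nat (@tofrac R)); apply: value_tofrac. Qed.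

(** Cross-multiplied representatives are equal already in R, so the value does
    not depend on the representative. *)
Lemma value_fun f v w : value f v -> value f w -> v = w.
Proof.
move=> [n [d [d0 fE vE]]] [n' [d' [d0' fE' wE]]].
have E : n * d' = n' * d.
  by apply/eqP; rewrite -tofrac_eq !rmorphM /= -fE -fE'; apply/eqP; ring.
apply: (mulIf d0); apply: (mulIf d0').
by rewrite vE -rmorphM E rmorphM -wE; ring.
Qed.

Lemma value_neq0 f v : value f v -> v != 0 -> f != 0.
Proof.
move=> fv; apply: contraNneq => f0; rewrite f0 in fv.
apply/eqP/(value_fun fv); rewrite -(rmorph0 (@tofrac R)) -(rmorph0 phi).
exact: value_tofrac.
Qed.

Lemma value_eq f v w : value f v -> v = w -> value f w.
Proof. by move=> + <-. Qed.

End Value.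

Lemma numden_tofrac (R : idomainType) (f : {fraction R}) :
  f * tofrac \d_(repr f) = tofrac \n_(repr f).
Proof.
rewrite -{1}[f]reprK; set y := repr f.
unlock tofrac; rewrite -[LHS]FracField.pi_mul.
apply/eqmodP; rewrite /= FracField.equivfE /FracField.mulf.
by rewrite !numden_Ratio ?mulf_neq0 ?oner_neq0 ?denom_ratioP //= !mulr1 mulrC.
Qed.

Lemma den_neq0 (R : idomainType) (f : {fraction R}) : tofrac \d_(repr f) != 0.
Proof. by rewrite tofrac_eq0 denom_ratioP. Qed.

Lemma fracE (R : idomainType) (f : {fraction R}) :
  f = tofrac \n_(repr f) / tofrac \d_(repr f).
Proof. by rewrite -numden_tofrac mulfK ?den_neq0. Qed.

(** * Substitutions and derivations of rational functions *)

Lemma mpoly_ring_ind (n : nat) (R : comNzRingType) (P : {mpoly R[n]} -> Prop) :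
    (forall c, P c%:MP) -> (forall i, P 'X_i) ->
    (forall p q, P p -> P q -> P (p + q)) ->
    (forall p q, P p -> P q -> P (p * q)) ->
  forall p, P p.
Proof.
move=> PC PX PD PM; have PXm m : P 'X_[m].
  rewrite mpolyXE_id; apply: big_ind => [|//|i _]; first exact: (PC 1).
  by elim: (m i) => [|k IHk]; [apply: (PC 1) | rewrite exprS; apply: PM].
elim/mpolyind => [|c m p _ _ Pp]; first by rewrite -mpolyC0.
by apply: PD => //; rewrite -mul_mpolyC; apply: PM.
Qed.

Lemma quotient_ruleD (L : fieldType) (n d n' d' m e m' e' : L) :
  d != 0 -> e != 0 ->
  ((n' * e + n * e' + (m' * d + m * d')) * (d * e)
    - (n * e + m * d) * (d' * e + d * e')) / (d * e) ^+ 2 =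
  (n' * d - n * d') / d ^+ 2 + (m' * e - m * e') / e ^+ 2.
Proof. by move=> d0 e0; field; rewrite d0 e0. Qed.

Lemma quotient_ruleM (L : fieldType) (n d n' d' m e m' e' : L) :
  d != 0 -> e != 0 ->
  ((n' * m + n * m') * (d * e) - n * m * (d' * e + d * e')) / (d * e) ^+ 2 =
  (n' * d - n * d') / d ^+ 2 * (m / e) + n / d * ((m' * e - m * e') / e ^+ 2).
Proof. by move=> d0 e0; field; rewrite d0 e0. Qed.

Section Rational.
Variable C : fieldType.
Local Notation K := (ratfun C).
Implicit Types (F G : 6.-tuple K) (f g : K).

HB.instance Definition _ := GRing.RMorphism.copy (@cst C) (@tofrac _ \o @mpolyC 6 C).

Definition evalpoint (s : seq C) : {rmorphism {mpoly C[6]} -> C} :=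
  mmap idfun (fun i : 'I_6 => s`_i).

Definition evalmap F : {rmorphism {mpoly C[6]} -> K} := mmap (@cst C) (tnth F).

Lemma value_cst F c : value (evalmap F) (cst c) (cst c).
Proof. by rewrite -[X in value _ _ X](mmapC (tnth F)); apply: value_tofrac. Qed.

Lemma value_coord F k : (k < 6)%N -> value (evalmap F) (coordinate C k) F`_k.
Proof.
move=> k6; apply: value_eq (value_tofrac _ _) _.
by rewrite /= mmapX mmap1U (tnth_nth 0) inordK.
Qed.

Lemma value_coord_point (s : seq C) k :
  (k < 6)%N -> value (evalpoint s) (coordinate C k) s`_k.
Proof.
move=> k6; apply: value_eq (value_tofrac _ _) _.
by rewrite /= mmapX mmap1U inordK.
Qed.

Definition coords : 6.-tuple K := [tuple q1; p1; q2; p2; t; s].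

Lemma coordsE (i : 'I_6) : tnth coords i = tofrac 'X_i.
Proof.
rewrite -[in RHS](inord_val i) (tnth_nth 0).
by case: i => -[|[|[|[|[|[|]]]]]].
Qed.

(** Algebraic independence of the entries of F. The record keeps the tactic
    done from unfolding the condition and computing in the field of fractions. *)
Record dominant F : Prop := Dominant {
  evalmap_neq0 : forall p : {mpoly C[6]}, p != 0 -> evalmap F p != 0 }.

(** Evaluating p(F) at G gives back p, so p(F) = 0 forces p = 0. *)
Lemma dominant_left_inverse F G :
  (forall i, value (evalmap G) (tnth F i) (tnth coords i)) -> dominant F.
Proof.
move=> GF; have GFp p : value (evalmap G) (evalmap F p) (tofrac p).
  elim/mpoly_ring_ind: p => [c|i|p q Pp Pq|p q Pp Pq].
  - by rewrite /= mmapC; apply: value_cst.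
  - by rewrite /= mmapX mmap1U -coordsE.
  - by rewrite !rmorphD; apply: valueD.
  - by rewrite !rmorphM; apply: valueM.
by split=> p p0; apply: value_neq0 (GFp p) _; rewrite tofrac_eq0.
Qed.

Lemma subst_value F f : dominant F -> value (evalmap F) f (subst F f).
Proof.
move=> domF; exists \n_(repr f), \d_(repr f); split.
- exact/(evalmap_neq0 domF)/denom_ratioP.
- exact: numden_tofrac.
- by rewrite mulfVK //; apply/(evalmap_neq0 domF)/denom_ratioP.
Qed.

Lemma subst_unique F f g : dominant F -> value (evalmap F) f g -> subst F f = g.
Proof. by move=> domF; apply: value_fun; apply: subst_value. Qed.

Lemma subst_cst F c : dominant F -> subst F (cst c) = cst c.
Proof. by move=> domF; apply/subst_unique/value_cst. Qed.

Lemma subst_coord F k : dominant F -> (k < 6)%N -> subst F (coordinate C k) = F`_k.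
Proof. by move=> domF k6; apply/subst_unique/value_coord. Qed.

Lemma subst_zmod_morphism F : dominant F -> zmod_morphism (subst F).
Proof. by move=> domF f g; apply/subst_unique/valueB; try apply: subst_value. Qed.

Lemma subst_monoid_morphism F : dominant F -> monoid_morphism (subst F).
Proof.
move=> domF; split=> [|f g]; first exact/subst_unique/value1.
by apply/subst_unique/valueM; try apply: subst_value.
Qed.

(** For a dominant F every denominator survives the substitution, which is
    therefore a morphism of fields. *)
Definition subst_morphism F (domF : dominant F) : {rmorphism K -> K} :=
  HB.pack (subst F)
    (GRing.isZmodMorphism.Build K K (subst F) (subst_zmod_morphism domF))
    (GRing.isMonoidMorphism.Build K K (subst F) (subst_monoid_morphism domF)).

(** Derivations over the constants, K being a module over itself through sigma
    on the target side; ordinary derivations have sigma = idfun, and both sides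
    of the chain rule have sigma = subst F. *)
Definition derivation_along (sigma D : K -> K) :=
  [/\ forall f g, D (f + g) = D f + D g,
      forall f g, D (f * g) = D f * sigma g + sigma f * D g
    & forall c, D (cst c) = 0].

(** Additivity and the Leibniz rule propagate equality to polynomials; for a
    fraction f = n / d, the Leibniz rule for n = f d determines D f. *)
Lemma derivation_ext (sigma : {rmorphism K -> K}) D E :
    derivation_along sigma D -> derivation_along sigma E ->
    (forall i, D (tnth coords i) = E (tnth coords i)) ->
  D =1 E.
Proof.
move=> [DD DM Dc] [ED EM Ec] DE.
have DEp p : D (tofrac p) = E (tofrac p).
  elim/mpoly_ring_ind: p => [c|i|p q Pp Pq|p q Pp Pq].
  - by rewrite Dc Ec.
  - by rewrite -coordsE.
  - by rewrite rmorphD DD ED Pp Pq.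
  - by rewrite rmorphM DM EM Pp Pq.
move=> f; have := DEp \n_(repr f); rewrite -numden_tofrac DM EM DEp => /addIr.
by apply: mulIf; rewrite fmorph_eq0 den_neq0.
Qed.

(** Differentiating n D = N d shows that the quotient rule gives the same result
    for the representatives n / d and N / D. *)
Lemma partialE i f n d : d != 0 -> f * tofrac d = tofrac n ->
  partial i f = tofrac (mderiv i n * d - n * mderiv i d) / tofrac (d ^+ 2).
Proof.
move=> d0 fd; have := numden_tofrac f; rewrite /partial.
have := denom_ratioP (repr f); set D := \d_(repr f); set N := \n_(repr f).
move=> D0 fD; have NdnD : n * D = N * d.
  by apply/eqP; rewrite -tofrac_eq !rmorphM /= -fd -fD; apply/eqP; ring.
have /(congr1 (@tofrac _)) := congr1 (mderiv i) NdnD.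
rewrite !mderivM !(rmorphD, rmorphN, rmorphM) /= -fd -fD => E.
apply/eqP; rewrite eqr_div ?mulf_neq0 ?tofrac_eq0 //; apply/eqP.
have {}E : tofrac N^`M(i) * tofrac d - f * tofrac d * tofrac D^`M(i) =
           tofrac n^`M(i) * tofrac D - f * tofrac D * tofrac d^`M(i).
  by apply/eqP; rewrite subr_eq addrAC eq_sym subr_eq E; apply/eqP; ring.
transitivity (tofrac D * tofrac d *
  (tofrac N^`M(i) * tofrac d - f * tofrac d * tofrac D^`M(i))); first by ring.
by rewrite E; ring.
Qed.

Lemma partial_tofrac i p : partial i (tofrac p : K) = tofrac (mderiv i p).
Proof.
rewrite (@partialE i _ p 1) ?oner_neq0 ?rmorph1 ?mulr1 //.
by rewrite expr1n rmorph1 invr1 -mpolyC1 mderivC mulr0 subr0 !mulr1.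
Qed.

Lemma partial_coord i j : partial i (tnth coords j) = (i == j)%:R.
Proof.
rewrite coordsE partial_tofrac mderivX mnm1E eq_sym.
case: eqP => [->|_]; last by rewrite scale0r rmorph0.
by rewrite -{1}[U_(_)%MM]add0m addmK mpolyX0 scale1r rmorph1.
Qed.

Lemma partial_derivation i : derivation_along idfun (@partial C i).
Proof.
split=> [f g|f g|c]; last by rewrite partial_tofrac mderivC rmorph0.
- have fE := numden_tofrac f; have gE := numden_tofrac g.
  rewrite (@partialE i _ (\n_(repr f) * \d_(repr g) + \n_(repr g) * \d_(repr f))
             (\d_(repr f) * \d_(repr g))); last 2 first.
  + by rewrite mulf_neq0 ?denom_ratioP.
  + by rewrite rmorphD !rmorphM /= -fE -gE; ring.
  rewrite /partial !mderivD !mderivM !tofracXn !tofracB !(tofracM, tofracD).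
  exact: quotient_ruleD (den_neq0 f) (den_neq0 g).
- have fE := numden_tofrac f; have gE := numden_tofrac g.
  rewrite (@partialE i _ (\n_(repr f) * \n_(repr g))
             (\d_(repr f) * \d_(repr g))); last 2 first.
  + by rewrite mulf_neq0 ?denom_ratioP.
  + by rewrite !rmorphM /= -fE -gE; ring.
  rewrite [in X in _ = _ + X * _](fracE f) [in X in _ = X + _](fracE g).
  rewrite /partial !mderivM !tofracXn !tofracB !(tofracM, tofracD).
  exact: quotient_ruleM (den_neq0 f) (den_neq0 g).
Qed.

(** Both sides are derivations along subst F with the same values at the
    coordinates. *)
Lemma subst_chain_rule F D : dominant F -> derivation_along idfun D ->
  forall f, D (subst F f) = \sum_j subst F (partial j f) * D (tnth F j).
Proof.
move=> domF [DD DM Dc]; pose sigma := subst_morphism domF.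
have sigmaE : subst F =1 sigma by [].
apply: (derivation_ext (sigma := sigma)); first split=> [f g|f g|c].
- by rewrite !sigmaE rmorphD DD.
- by rewrite !sigmaE rmorphM DM.
- by rewrite subst_cst.
- split=> [f g|f g|c].
  + rewrite -big_split /=; apply: eq_bigr => j _.
    by case: (partial_derivation j) => -> _ _; rewrite !sigmaE rmorphD mulrDl.
  + rewrite mulr_suml mulr_sumr -big_split /=; apply: eq_bigr => j _.
    case: (partial_derivation j) => _ -> _.
    by rewrite !sigmaE rmorphD !rmorphM /=; ring.
  + rewrite big1 // => j _; case: (partial_derivation j) => _ _ ->.
    by rewrite sigmaE rmorph0 mul0r.
- move=> i; rewrite [in LHS]coordsE -[i in LHS]inord_val.
  rewrite (subst_coord (k := i)) // -tnth_nth (bigD1 i) //= partial_coord eqxx.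
  rewrite sigmaE rmorph1 mul1r big1 ?addr0 // => j ji.
  by rewrite partial_coord (negPf ji) sigmaE rmorph0 mul0r.
Qed.

End Rational.

(** * Solutions of the Hamiltonian system and elementary maps *)

Lemma neq0_eq (L : fieldType) (y z : L) : y != 0 -> z = y -> z != 0.
Proof. by move=> ? ->. Qed.

Lemma neq0_opp (L : fieldType) (y z : L) : y != 0 -> z = - y -> z != 0.
Proof. by move=> ? ->; rewrite oppr_eq0. Qed.

(** The side conditions of field are, up to sign and the ring axioms, among the
    nonvanishing facts in the context. *)
Ltac nonzero := solve [done | exact: oner_neq0 | multimatch goal with
  | h : is_true (_ != 0) |- _ =>
    solve [by apply: (neq0_eq h); ring | by apply: (neq0_opp h); ring]
  end].

Section VectorField.
Variable L : fieldType.
Implicit Types (q p t eta : L) (x a : seq L).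

(** Partial derivatives of the Hamiltonians. A point is a sequence
    q1, p1, q2, p2, t, s and the parameters are a sequence a0, ..., a6, both read
    with nth and default value 0. The sum of parameters that divides the coupling
    term is replaced by its value 1. *)
Definition HVIp q p t eta b1 b2 b3 b4 : L :=
  (2 * q * (q - 1) * (q - eta) * (q - t) * p
   + (b1 * (t - eta) * q * (q - 1) + 2 * b2 * q * (q - 1) * (q - eta)
      + b3 * (t - 1) * q * (q - eta) + b4 * t * (q - 1) * (q - eta)))
  / (t * (t - 1) * (t - eta)).

Definition HVIq q p t eta b1 b2 b3 b4 : L :=
  (((q - 1) * (q - eta) * (q - t) + q * (q - eta) * (q - t)
    + q * (q - 1) * (q - t) + q * (q - 1) * (q - eta)) * p ^+ 2
   + (b1 * (t - eta) * (2 * q - 1)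
      + 2 * b2 * ((q - 1) * (q - eta) + q * (q - eta) + q * (q - 1))
      + b3 * (t - 1) * (2 * q - eta) + b4 * t * (2 * q - 1 - eta)) * p
   + b2 * ((b1 + b2) * (t - eta) + b2 * (2 * q - 1) + b3 * (t - 1) + t * b4))
  / (t * (t - 1) * (t - eta)).

Definition Hq1 x a : L :=
  HVIq x`_0 x`_1 x`_4 x`_5 a`_1 a`_2 (a`_3 + 2 * a`_4 + a`_5) (a`_3 + a`_6)
  + 2 * x`_2 * ((x`_0 - x`_4) * x`_1 + a`_2 + (x`_0 - x`_5) * x`_1)
    * ((x`_2 - 1) * x`_3 + a`_4) / (x`_4 * (x`_4 - 1) * (x`_4 - x`_5)).

Definition Hp1 x a : L :=
  HVIp x`_0 x`_1 x`_4 x`_5 a`_1 a`_2 (a`_3 + 2 * a`_4 + a`_5) (a`_3 + a`_6)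
  + 2 * (x`_0 - x`_5) * x`_2 * (x`_0 - x`_4) * ((x`_2 - 1) * x`_3 + a`_4)
    / (x`_4 * (x`_4 - 1) * (x`_4 - x`_5)).

Definition Hq2 x a : L :=
  HVIq x`_2 x`_3 x`_4 x`_5 (a`_1 + a`_3) a`_4 a`_5 a`_6
  + 2 * (x`_0 - x`_5) * ((x`_0 - x`_4) * x`_1 + a`_2)
    * ((x`_2 - 1) * x`_3 + a`_4 + x`_2 * x`_3)
    / (x`_4 * (x`_4 - 1) * (x`_4 - x`_5)).

Definition Hp2 x a : L :=
  HVIp x`_2 x`_3 x`_4 x`_5 (a`_1 + a`_3) a`_4 a`_5 a`_6
  + 2 * (x`_0 - x`_5) * x`_2 * ((x`_0 - x`_4) * x`_1 + a`_2) * (x`_2 - 1)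
    / (x`_4 * (x`_4 - 1) * (x`_4 - x`_5)).

Definition swap_times x : seq L := [:: x`_0; x`_1; x`_2; x`_3; x`_5; x`_4].
Definition swap_params a : seq L :=
  [:: a`_1; a`_0; a`_2; a`_3; a`_4; a`_5; a`_6].

Definition times_ok x : bool :=
  [&& x`_4 != 0, x`_4 - 1 != 0, x`_5 != 0, x`_5 - 1 != 0 & x`_4 - x`_5 != 0].

Definition sum_params a : L :=
  a`_0 + a`_1 + 2 * a`_2 + 2 * a`_3 + 2 * a`_4 + a`_5 + a`_6.

Definition adj (i j : nat) : bool :=
  ((i, j) \in D6edges) || ((j, i) \in D6edges).

Definition reflect_params k a : seq L :=
  mkseq (fun j => if j == k then - a`_k
                  else if adj k j then a`_j + a`_k else a`_j) 7.

(** The affine functions whose zero sets are the poles of the s_k. *)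
Definition mirror k x : L :=
  nth 0 [:: x`_0 - x`_4; x`_0 - x`_5; x`_1; x`_0 - x`_2; x`_3; x`_2 - 1; x`_2] k.

(** The Hamiltonian vector fields of the mirrors; trailing zeros are omitted. *)
Definition direction k : seq L :=
  nth [::] [:: [:: 0; - 1]; [:: 0; - 1]; [:: 1]; [:: 0; - 1; 0; 1];
               [:: 0; 0; 1]; [:: 0; 0; 0; - 1]; [:: 0; 0; 0; - 1]] k.

Definition shear k x a : seq L :=
  mkseq (fun j => x`_j + a`_k / mirror k x * (direction k)`_j) 6.

(** The Moebius transformation q -> q / ((1 - e) q + e), which fixes 0 and 1,
    applied to q1, q2, t and s. With e fixed, the new momentum P satisfies
    P dQ = p dq + b dM / M where M = (1 - e) q + e: it is the canonical lift
    corrected by a logarithmic term with coefficient b. *)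
Definition gauge (e : L) x a : seq L :=
  let M q := (1 - e) * q + e in
  let P q p b := M q * (M q * p + (1 - e) * b) / e in
  [:: x`_0 / M x`_0; P x`_0 x`_1 a`_2; x`_2 / M x`_2; P x`_2 x`_3 a`_4;
      x`_4 / M x`_4; x`_5 / M x`_5].

Definition gauge_ok e x : bool :=
  let M q := (1 - e) * q + e in
  [&& e != 0, M x`_0 != 0, M x`_2 != 0, M x`_4 != 0 & M x`_5 != 0].

Definition flip x : seq L :=
  [:: 1 - x`_0; - x`_1; 1 - x`_2; - x`_3; 1 - x`_4; 1 - x`_5].

Definition flip_params a : seq L :=
  [:: a`_0; a`_1; a`_2; a`_3; a`_4; a`_6; a`_5].

(** The affine transformation q -> (q - s) / (t - s), which takes t, s to 1, 0,
    composed with the exchange of the two pairs (q1, p1) and (q2, p2); the new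
    t and s are the images of 1 and 0. *)
Definition turn x : seq L :=
  let c := x`_4 - x`_5 in
  [:: (x`_2 - x`_5) / c; c * x`_3; (x`_0 - x`_5) / c; c * x`_1;
      (1 - x`_5) / c; x`_5 / - c].

Definition turn_params a : seq L :=
  [:: a`_5; a`_6; a`_4; a`_3; a`_2; a`_0; a`_1].

Variable D : L -> L.

(** The second summands are the vector field of H2, which is H1 with t, s and
    a0, a1 exchanged. *)
Definition flow x a : Prop :=
  [/\ D x`_0 = Hp1 x a * D x`_4 + Hp1 (swap_times x) (swap_params a) * D x`_5,
      D x`_1 = - (Hq1 x a * D x`_4 + Hq1 (swap_times x) (swap_params a) * D x`_5),
      D x`_2 = Hp2 x a * D x`_4 + Hp2 (swap_times x) (swap_params a) * D x`_5
    & D x`_3 = - (Hq2 x a * D x`_4 + Hq2 (swap_times x) (swap_params a) * D x`_5)].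

Hypothesis DD : forall f g, D (f + g) = D f + D g.
Hypothesis DM : forall f g, D (f * g) = D f * g + f * D g.

Lemma D1 : D 1 = 0.
Proof.
have := DM 1 1; rewrite !mulr1 mul1r => /eqP.
by rewrite -subr_eq subrr eq_sym => /eqP.
Qed.

Lemma D0 : D 0 = 0.
Proof. by have := DM 0 0; rewrite !mul0r !mulr0 addr0. Qed.

Lemma DN f : D (- f) = - D f.
Proof. by apply/eqP; rewrite -addr_eq0 -DD addNr D0. Qed.

Lemma DV f : D f^-1 = - (D f / f ^+ 2).
Proof.
have [->|f0] := eqVneq f 0; first by rewrite invr0 D0 mul0r oppr0.
have := DM f^-1 f; rewrite mulVf // D1 => /esym/eqP; rewrite addr_eq0 => /eqP E.
by apply: (mulIf f0); rewrite E; field.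
Qed.

Definition derivE := (DD, DM, DN, DV, D1).

Lemma flow_swap x a : flow x a -> flow (swap_times x) (swap_params a).
Proof. by case=> E0 E1 E2 E3; split; rewrite /= addrC. Qed.

Section Step.
Variables x a : seq L.
Hypotheses (x_ok : times_ok x) (a_sum : sum_params a = 1).
Hypotheses (Da : forall i, D a`_i = 0) (fl : flow x a).

(* H1 does not contain a0 and H2 does not contain a1: the identities below need
   the normalization of the parameters. *)
Let a0E : a`_0 = 1 - (a`_1 + 2 * a`_2 + 2 * a`_3 + 2 * a`_4 + a`_5 + a`_6).
Proof. by rewrite -[X in X - _]a_sum /sum_params; ring. Qed.

Lemma flow_shear k : (k < 7)%N -> mirror k x != 0 ->
  flow (shear k x a) (reflect_params k a).
Proof.
case/and5P: x_ok => t0 t1 s0 s1 ts; case: fl => E0 E1 E2 E3.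
have st : x`_5 - x`_4 != 0 by rewrite -opprB oppr_eq0.
case: k => [|[|[|[|[|[|[|//]]]]]]] _ /= m0;
  rewrite /flow /Hq1 /Hp1 /Hq2 /Hp2 /HVIp /HVIq /= /mirror /= !(mulr0, addr0);
  rewrite !derivE !Da {}E0 {}E1 {}E2 {}E3;
  rewrite /Hq1 /Hp1 /Hq2 /Hp2 /HVIp /HVIq /= a0E; split; field;
  by rewrite ?t0 ?t1 ?s0 ?s1 ?ts ?st ?m0.
Qed.

(** The derivative D e is arbitrary: its coefficient vanishes because the vector
    field t (t - 1) X_H1 + s (s - 1) X_H2 on the space of the q_i, p_i is the
    lift of the infinitesimal Moebius transformation q (q - 1) d/dq. *)
Lemma flow_gauge e : gauge_ok e x -> flow (gauge e x a) a.
Proof.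
case/and5P: x_ok => t0 t1 s0 s1 ts /and5P[e0 q1M q2M tM sM].
case: fl => E0 E1 E2 E3.
have st : x`_5 - x`_4 != 0 by rewrite -opprB oppr_eq0.
have et1 := mulf_neq0 e0 t1; have es1 := mulf_neq0 e0 s1.
have ets := mulf_neq0 e0 ts; have est := mulf_neq0 e0 st.
rewrite /flow /= !derivE !Da {}E0 {}E1 {}E2 {}E3.
rewrite /Hq1 /Hp1 /Hq2 /Hp2 /HVIp /HVIq /= a0E.
by split; field; do ?[apply/andP; split]; nonzero.
Qed.

Lemma flow_flip : flow (flip x) (flip_params a).
Proof.
case/and5P: x_ok => t0 t1 s0 s1 ts; case: fl => E0 E1 E2 E3.
have st : x`_5 - x`_4 != 0 by rewrite -opprB oppr_eq0.
rewrite /flow /= !derivE {}E0 {}E1 {}E2 {}E3.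
rewrite /Hq1 /Hp1 /Hq2 /Hp2 /HVIp /HVIq /= a0E.
by split; field; do ?[apply/andP; split]; nonzero.
Qed.

Lemma flow_turn : flow (turn x) (turn_params a).
Proof.
case/and5P: x_ok => t0 t1 s0 s1 ts; case: fl => E0 E1 E2 E3.
have st : x`_5 - x`_4 != 0 by rewrite -opprB oppr_eq0.
rewrite /flow /= !derivE {}E0 {}E1 {}E2 {}E3.
rewrite /Hq1 /Hp1 /Hq2 /Hp2 /HVIp /HVIq /= a0E.
split; field; do ?[apply/andP; split]; nonzero.
Qed.

End Step.
End VectorField.

(** * Relations between shears *)

Section Shears.
Variable L : fieldType.
Implicit Types (x a : seq L) (c d e u w : L).

Definition push k c x : seq L := mkseq (fun j => x`_j + c * (direction L k)`_j) 6.

Lemma shearE k x a : shear k x a = push k (a`_k / mirror k x) x.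
Proof. by []. Qed.

Lemma eq_mkseq_nat (f g : nat -> L) n :
  (forall j, (j < n)%N -> f j = g j) -> mkseq f n = mkseq g n.
Proof.
move=> fg; apply: (@eq_from_nth _ 0); rewrite !size_mkseq // => j jn.
by rewrite !nth_mkseq // fg.
Qed.

Lemma pushC i j c d x : push i c (push j d x) = push j d (push i c x).
Proof. by apply: eq_mkseq_nat => k k6; rewrite !nth_mkseq // addrAC. Qed.

Lemma pushD k c d x : push k c (push k d x) = push k (c + d) x.
Proof. by apply: eq_mkseq_nat => j j6; rewrite nth_mkseq // mulrDl addrA addrAC. Qed.

Lemma push0 k x : size x = 6 -> push k 0 x = x.
Proof.
move=> x6; rewrite -[RHS](mkseq_nth 0) x6.
by apply: eq_mkseq_nat => j _; rewrite mul0r addr0.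
Qed.

Lemma mirror_push_self k c x : mirror k (push k c x) = mirror k x.
Proof.
by case: k => [|[|[|[|[|[|[|k]]]]]]] /=; rewrite /mirror /= ?nth_nil; ring.
Qed.

(** The Poisson bracket e of two mirrors is antisymmetric, and is 1 or - 1 exactly
    for adjacent nodes. *)
Lemma mirror_push i j : (i < 7)%N -> (j < 7)%N -> i != j ->
  exists e, [/\ forall c x, mirror j (push i c x) = mirror j x + c * e,
                forall c x, mirror i (push j c x) = mirror i x - c * e &
                if adj i j then e = 1 \/ e = - 1 else e = 0].
Proof.
case: i => [|[|[|[|[|[|[|//]]]]]]] _; case: j => [|[|[|[|[|[|[|//]]]]]]] _ //= _;
  rewrite /mirror /=;
  first [ exists 0; split=> [c x|c x|]; [by ring | by ring | by []]
        | exists 1; split=> [c x|c x|]; [by ring | by ring | by left]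
        | exists (- 1); split=> [c x|c x|]; [by ring | by ring | by right]].
Qed.

(** A shear does not move its own mirror, and the parameter a_k changes sign. *)
Lemma shear_involutive k x a : (k < 7)%N -> size x = 6 ->
  shear k (shear k x a) (reflect_params k a) = x.
Proof.
move=> k7 x6; rewrite !shearE mirror_push_self nth_mkseq // eqxx pushD.
by rewrite -mulrDl addNr mul0r push0.
Qed.

Lemma reflect_self k a : (k < 7)%N -> (reflect_params k a)`_k = - a`_k.
Proof. by move=> k7; rewrite nth_mkseq ?eqxx. Qed.

Lemma reflect_other k j a : (j < 7)%N -> j != k ->
  (reflect_params k a)`_j = if adj k j then a`_j + a`_k else a`_j.
Proof. by move=> j7 jk; rewrite nth_mkseq // (negPf jk). Qed.

Lemma reflect_involutive k a : (k < 7)%N -> size a = 7 ->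
  reflect_params k (reflect_params k a) = a.
Proof.
move=> k7 a7; rewrite -[RHS](mkseq_nth 0) a7; apply: eq_mkseq_nat => j j7.
have [->|jk] := eqVneq j k; first by rewrite reflect_self // opprK.
rewrite !(reflect_other _ j7 jk) reflect_self //.
by case: (adj k j) => //; rewrite addrK.
Qed.

Definition step k (z : seq L * seq L) := (shear k z.1 z.2, reflect_params k z.2).

Lemma adjC i j : adj i j = adj j i.
Proof. by rewrite /adj orbC. Qed.

Lemma reflect_commute i j a : (i < 7)%N -> (j < 7)%N -> i != j -> ~~ adj i j ->
  reflect_params i (reflect_params j a) = reflect_params j (reflect_params i a).
Proof.
move=> i7 j7 ij nij; have nji : ~~ adj j i by rewrite adjC.
have ji : j != i by rewrite eq_sym.
apply: eq_mkseq_nat => k k7; rewrite (reflect_other a i7 ij) (reflect_other a j7 ji).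
rewrite (negPf nij) (negPf nji).
have [->|ki] := eqVneq k i; first by rewrite (negPf ij) (negPf nji) reflect_self.
rewrite (reflect_other a k7 ki).
have [->|kj] := eqVneq k j; first by rewrite reflect_self // (negPf nij).
by rewrite reflect_other //; do 2 case: (adj _ _); rewrite // addrAC.
Qed.

Lemma step_commute i j z : (i < 7)%N -> (j < 7)%N -> i != j -> ~~ adj i j ->
  step i (step j z) = step j (step i z).
Proof.
move=> i7 j7 ij nij; case: z => x a; congr pair; last exact: reflect_commute.
have [e [Ej Ei]] := mirror_push i7 j7 ij; rewrite (negPf nij) => e0.
rewrite /= !shearE Ei Ej e0 !(mulr0, subr0, addr0) pushC.
rewrite !reflect_other //; last by rewrite eq_sym.
by rewrite (negPf nij) adjC (negPf nij).
Qed.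

Lemma reflect_braid i j a : (i < 7)%N -> (j < 7)%N -> adj i j ->
  reflect_params i (reflect_params j (reflect_params i a)) =
  reflect_params j (reflect_params i (reflect_params j a)).
Proof.
by case: i => [|[|[|[|[|[|[|//]]]]]]] _; case: j => [|[|[|[|[|[|[|//]]]]]]] _ // _;
  rewrite /reflect_params /mkseq /=; do ?congr (_ :: _); ring.
Qed.

(** The total displacements along the directions of i and j produced by s_i s_j s_i
    and by s_j s_i s_j, where u, w are the two mirrors and a, b the two
    parameters. *)
Lemma braid_coefficients (e u w a b : L) : e = 1 \/ e = - 1 ->
    u != 0 -> w != 0 -> w + a / u * e != 0 -> u - b / w * e != 0 ->
  let w1 := w + a / u * e in let u2 := u - (a + b) / w1 * e in
  let u1 := u - b / w * e in let w2 := w + (a + b) / u1 * e in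
  a / u + b / u2 = (a + b) / u1 /\ (a + b) / w1 = b / w + a / w2.
Proof.
move=> e1 u0 w0 w1 u1 /=.
have {}w1 : w * u + a * e != 0.
  apply: contraNneq w1 => E; apply/eqP.
  by transitivity ((w * u + a * e) / u); [field | rewrite E mul0r].
have {}u1 : u * w - b * e != 0.
  apply: contraNneq u1 => E; apply/eqP.
  by transitivity ((u * w - b * e) / w); [field | rewrite E mul0r].
have uu1 := mulf_neq0 u0 u1; have ww1 := mulf_neq0 w0 w1.
case: e1 => e1; move: w1 u1 uu1 ww1; rewrite e1 => w1 u1 uu1 ww1;
  by split; field; do ?[apply/andP; split]; nonzero.
Qed.

Lemma step_braid i j z : (i < 7)%N -> (j < 7)%N -> adj i j -> i != j ->
    mirror i z.1 != 0 -> mirror j z.1 != 0 ->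
    mirror j (step i z).1 != 0 -> mirror i (step j z).1 != 0 ->
  step i (step j (step i z)) = step j (step i (step j z)).
Proof.
case: z => x a i7 j7 ij neij u0 w0 w1 u1.
congr pair; last by rewrite /= reflect_braid.
have [e [Ej Ei]] := mirror_push i7 j7 neij; rewrite ij => e1.
move: w1 u1; rewrite /= !shearE Ei Ej => w1 u1.
have neji : j != i by rewrite eq_sym.
have ji : adj j i by rewrite adjC.
have A1 : (reflect_params i a)`_j = a`_i + a`_j.
  by rewrite reflect_other // ij addrC.
have A2 : (reflect_params j (reflect_params i a))`_i = a`_j.
  by rewrite reflect_other // ji A1 reflect_self // addKr.
have B1 : (reflect_params j a)`_i = a`_i + a`_j.
  by rewrite reflect_other // ji.
have B2 : (reflect_params i (reflect_params j a))`_j = a`_i.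
  by rewrite reflect_other // ij B1 reflect_self // addrC addrK.
rewrite !(mirror_push_self, Ei, Ej) A2 A1 B2 B1.
have [E1 E2] := braid_coefficients e1 u0 w0 w1 u1.
rewrite pushC pushD [_ + a`_i / _]addrC E1 [in RHS]pushC pushD [_ + a`_j / _]addrC.
by rewrite E2 pushC.
Qed.
End Shears.

(** * Moebius transformations and their inverses *)

Section Moebius.
Variable L : fieldType.
Implicit Types (x y a : seq L) (e : L).

Lemma size6E x : size x = 6 -> x = [:: x`_0; x`_1; x`_2; x`_3; x`_4; x`_5].
Proof. by case: x => [|? [|? [|? [|? [|? [|? []]]]]]]. Qed.

Lemma gaugeK e e' x a : size x = 6 -> gauge_ok e x -> e' = e^-1 ->
  gauge e' (gauge e x a) a = x.
Proof.
move=> x6 /and5P[e0 q1M q2M tM sM] ->; rewrite [RHS]size6E // /gauge /=.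
do ?congr (_ :: _); field; do ?[apply/andP; split]; nonzero.
Qed.

(** The new denominator is the inverse of the old one. *)
Lemma gauge_ok_inv e x a : gauge_ok e x -> gauge_ok e^-1 (gauge e x a).
Proof.
case/and5P => e0 q1M q2M tM sM.
have M q : (1 - e) * q + e != 0 ->
    (1 - e^-1) * (q / ((1 - e) * q + e)) + e^-1 != 0.
  move=> Mq; rewrite (_ : _ + _ = ((1 - e) * q + e)^-1) ?invr_neq0 //.
  by field; rewrite e0 Mq.
by rewrite /gauge_ok /= invr_neq0 // !M.
Qed.

Lemma swap_gauge e x a : swap_times (gauge e x a) = gauge e (swap_times x) a.
Proof. by []. Qed.

Lemma swapK x : size x = 6 -> swap_times (swap_times x) = x.
Proof. by move=> x6; rewrite [RHS]size6E. Qed.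

Lemma flipK x : size x = 6 -> flip (flip x) = x.
Proof.
by move=> x6; rewrite [RHS]size6E // /flip /= !opprK; do ?congr (_ :: _); ring.
Qed.

Lemma turnK x : size x = 6 -> x`_4 - x`_5 != 0 -> turn (turn x) = x.
Proof.
move=> x6 ts; rewrite [RHS]size6E // /turn /=.
do ?congr (_ :: _); field; do ?[apply/andP; split]; nonzero.
Qed.

(** The parameters e for pi1, pi3 and the inverse of pi3. They are determined by
    the prescribed new value of s: for pi1 the point t goes to 1 / s, and for pi3,
    after the turn, the point s goes to 1 / (1 - s). *)
Definition pi1_gauge x : L := x`_4 * (1 - x`_5) / (x`_4 - 1).
Definition pi3_gauge x : L := x`_5 ^+ 2 / x`_4.
Definition pi3_inv_den x : L := x`_4 * (x`_5 ^+ 2 - x`_5 + 1) - x`_5.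
Definition pi3_inv_gauge x : L := x`_4 * x`_5 ^+ 2 / pi3_inv_den x.

(** The maps pi1, pi3 and the inverse of pi3 on points. The map pi3 is not an
    involution, since it acts on s by s -> 1 / (1 - s), which has order 3. *)
Definition pi1_point x a := gauge (pi1_gauge x) (swap_times x) a.
Definition pi3_point x a := gauge (pi3_gauge x) (turn x) (turn_params a).
Definition pi3_inv_point x a := turn (gauge (pi3_inv_gauge x) x a).

(** The exchange of t and s commutes with gauge transformations, so pi1 is an
    involution as soon as its parameter e at the image point is the inverse. *)
Lemma pi1_gauge_inv x a : times_ok x -> gauge_ok (pi1_gauge x) (swap_times x) ->
  (pi1_point x a)`_4 - 1 != 0 /\ pi1_gauge (pi1_point x a) = (pi1_gauge x)^-1.
Proof.
case/and5P => t0 t1 s0 s1 ts /and5P[e0 _ _ /= sM _].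
have {}sM : x`_5 * (x`_4 * x`_5 - 1) + x`_4 * (1 - x`_5) != 0.
  apply: contraNneq sM => E; rewrite /pi1_gauge; apply/eqP.
  transitivity ((x`_5 * (x`_4 * x`_5 - 1) + x`_4 * (1 - x`_5)) / (x`_4 - 1)).
    by field.
  by rewrite E mul0r.
have T1 : (pi1_point x a)`_4 - 1 = - (x`_4 * (1 - x`_5) ^+ 2) /
    (x`_5 * (x`_4 * x`_5 - 1) + x`_4 * (1 - x`_5)).
  by rewrite /= /pi1_gauge; field; do ?[apply/andP; split]; nonzero.
have s1' : 1 - x`_5 != 0 by nonzero.
have ts1 := mulf_neq0 (mulf_neq0 t0 s0) t1.
have d0 := mulf_neq0 t0 (mulf_neq0 s1' s1').
split; first by rewrite T1 mulf_neq0 ?invr_neq0 // oppr_eq0 mulf_neq0 ?expf_neq0.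
rewrite {1}/pi1_gauge /= /pi1_gauge; field; do ?[apply/andP; split]; nonzero.
Qed.

Lemma pi1_pointK x a :
    size x = 6 -> times_ok x -> gauge_ok (pi1_gauge x) (swap_times x) ->
  pi1_point (pi1_point x a) a = x.
Proof.
move=> x6 x_ok g_ok; have [_ E] := pi1_gauge_inv a x_ok g_ok.
rewrite {1}/pi1_point E /pi1_point swap_gauge swapK //; apply: gaugeK => //.
by case/and5P: g_ok => *; apply/and5P; split.
Qed.

Lemma pi3_gauge_inv x a : times_ok x -> gauge_ok (pi3_gauge x) (turn x) ->
  pi3_inv_den (pi3_point x a) != 0 /\
  pi3_inv_gauge (pi3_point x a) = (pi3_gauge x)^-1.
Proof.
case/and5P => t0 t1 s0 s1 ts /and5P[e0 _ _ tM sM].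
have {sM}T0 : x`_4 + x`_5 ^+ 2 * (x`_4 - 1) - x`_4 * x`_5 != 0.
  apply: contraNneq tM => E; rewrite /= /pi3_gauge; apply/eqP.
  transitivity ((x`_4 + x`_5 ^+ 2 * (x`_4 - 1) - x`_4 * x`_5)
    / (x`_4 * (x`_4 - x`_5))).
    by field; do ?[apply/andP; split]; nonzero.
  by rewrite E mul0r.
have s1' : 1 - x`_5 != 0 by nonzero.
have st : x`_5 - x`_4 != 0 by nonzero.
have ss := mulf_neq0 s0 s0.
have tss := mulf_neq0 t0 (mulf_neq0 s0 s1').
have tsst := mulf_neq0 ts tss; have Ns1 := mulf_neq0 T0 s1'.
have D1 : pi3_inv_den (pi3_point x a) = x`_5 ^+ 2 / ((1 - x`_5) *
    (x`_4 + x`_5 ^+ 2 * (x`_4 - 1) - x`_4 * x`_5)).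
  rewrite /pi3_inv_den /= /pi3_gauge; field; do ?[apply/andP; split]; nonzero.
split; first by rewrite D1 mulf_neq0 ?invr_neq0 ?expf_neq0 // mulf_neq0.
rewrite /pi3_inv_gauge D1 /= /pi3_gauge; field; do ?[apply/andP; split]; nonzero.
Qed.

Lemma pi3_inv_gauge_inv x a :
    times_ok x -> pi3_inv_den x != 0 -> gauge_ok (pi3_inv_gauge x) x ->
  let y := gauge (pi3_inv_gauge x) x a in
  [/\ y`_4 - y`_5 != 0, (turn y)`_4 != 0 &
      pi3_gauge (pi3_inv_point x a) = (pi3_inv_gauge x)^-1].
Proof.
rewrite /pi3_inv_point; set e := pi3_inv_gauge x.
have eE : e = x`_4 * x`_5 ^+ 2 / pi3_inv_den x by [].
move: e eE => e eE; case/and5P => t0 t1 s0 s1 ts d0 /and5P[e0 _ _ tM sM].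
have s1' : 1 - x`_5 != 0 by nonzero.
have est := mulf_neq0 e0 ts; have es1 := mulf_neq0 e0 s1.
have Y : x`_4 / ((1 - e) * x`_4 + e) - x`_5 / ((1 - e) * x`_5 + e)
    = e * (x`_4 - x`_5) / (((1 - e) * x`_4 + e) * ((1 - e) * x`_5 + e)).
  by field; rewrite tM sM.
have Y1 : 1 - x`_5 / ((1 - e) * x`_5 + e) = e * (1 - x`_5) / ((1 - e) * x`_5 + e).
  by field.
have Y0 : e * (x`_4 - x`_5) / (((1 - e) * x`_4 + e) * ((1 - e) * x`_5 + e)) != 0.
  by rewrite !(mulf_neq0, invr_neq0).
split; rewrite /= ?Y ?Y1 // ?(mulf_neq0, invr_neq0) //.
rewrite /pi3_gauge /= Y Y1.
have EM : (1 - e) * x`_4 + e = x`_4 * (x`_4 - x`_5) * (1 - x`_5) / pi3_inv_den x.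
  by rewrite eE /pi3_inv_den; field.
transitivity (x`_5 ^+ 2 * ((1 - e) * x`_4 + e)
    / (e ^+ 2 * (x`_4 - x`_5) * (1 - x`_5))).
  by field; do ?[apply/andP; split]; nonzero.
have dE : e * pi3_inv_den x = x`_4 * x`_5 ^+ 2 by rewrite eE divfK.
rewrite EM; transitivity (x`_4 * x`_5 ^+ 2 / (e ^+ 2 * pi3_inv_den x)).
  by field; do ?[apply/andP; split]; nonzero.
by rewrite -dE; field; rewrite d0 e0.
Qed.

Lemma pi3_inv_pointK x a : size x = 6 -> times_ok x ->
    pi3_inv_den x != 0 -> gauge_ok (pi3_inv_gauge x) x ->
  pi3_point (pi3_inv_point x a) (turn_params a) = x.
Proof.
move=> x6 x_ok d0 g_ok; have [y45 _ E] := pi3_inv_gauge_inv a x_ok d0 g_ok.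
by rewrite /pi3_point E /pi3_inv_point turnK // [LHS]gaugeK.
Qed.

End Moebius.

(** The elementary maps are rational: they commute with evaluation wherever their
    denominators do not vanish. *)
Section ValueMaps.
Variables (R : idomainType) (L : fieldType) (phi : {rmorphism R -> L}).
Local Notation value := (value phi).
Variables (x a : seq {fraction R}) (y b : seq L).
Hypotheses (xy : forall i, value x`_i y`_i) (ab : forall i, value a`_i b`_i).

Lemma value0 : value 0 0. Proof. exact: (value_nat phi 0). Qed.

Lemma value_shear k : mirror k y != 0 ->
  forall i, value (shear k x a)`_i (shear k y b)`_i.
Proof.
move=> m0 i; have [i6|i6] := ltnP i 6; last first.
  by rewrite !nth_default ?size_mkseq //; apply: value0.
rewrite !nth_mkseq //; apply: valueD => //; apply: valueM; last first.
  have N := valueN (value1 phi); move: (value1 phi) (value0) N => ? ? ?.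
  by case: k {m0} => [|[|[|[|[|[|[|k]]]]]]]; case: i i6 => [|[|[|[|[|[|i]]]]]] // _;
    rewrite /direction /= ?nth_nil.
apply: valueM => //; apply: valueV m0.
case: k => [|[|[|[|[|[|[|k]]]]]]]; rewrite /mirror /= ?nth_nil //;
  by [apply: valueB | apply: valueB (value1 _) | apply: value0].
Qed.

Lemma value_gauge e e' : value e e' -> gauge_ok e' y ->
  forall i, value (gauge e x a)`_i (gauge e' y b)`_i.
Proof.
move=> ee' /and5P[e0 q1M q2M tM sM].
have MV i : value ((1 - e) * x`_i + e) ((1 - e') * y`_i + e').
  by apply: valueD => //; apply: valueM => //; apply: valueB => //; apply: value1.
have QV i : (1 - e') * y`_i + e' != 0 ->
    value (x`_i / ((1 - e) * x`_i + e)) (y`_i / ((1 - e') * y`_i + e')).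
  by move=> M0; apply: valueM => //; apply: valueV.
have PV i j k : value
    (((1 - e) * x`_i + e) * (((1 - e) * x`_i + e) * x`_j + (1 - e) * a`_k) / e)
    (((1 - e') * y`_i + e') * (((1 - e') * y`_i + e') * y`_j + (1 - e') * b`_k) / e').
  apply: valueM; last exact: valueV.
  apply: valueM => //; apply: valueD; apply: valueM => //.
  by apply: valueB => //; apply: value1.
by case=> [|[|[|[|[|[|i]]]]]]; rewrite /gauge /= ?nth_nil;
  [apply: QV | apply: PV | apply: QV | apply: PV | apply: QV | apply: QV |
   apply: value0].
Qed.

Lemma value_flip i : value (flip x)`_i (flip y)`_i.
Proof.
have V1 := value1 phi.
by case: i => [|[|[|[|[|[|i]]]]]]; rewrite /flip /= ?nth_nil;
  [apply: valueB | apply: valueN | apply: valueB | apply: valueN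
  | apply: valueB | apply: valueB | apply: value0].
Qed.

Lemma value_swap i : value (swap_times x)`_i (swap_times y)`_i.
Proof.
by case: i => [|[|[|[|[|[|i]]]]]]; rewrite /swap_times //= !nth_nil; apply: value0.
Qed.

Lemma value_turn : y`_4 - y`_5 != 0 -> forall i, value (turn x)`_i (turn y)`_i.
Proof.
move=> ts; have V1 := value1 phi.
have cV : value (x`_4 - x`_5) (y`_4 - y`_5) by apply: valueB.
have dV : value (x`_4 - x`_5)^-1 (y`_4 - y`_5)^-1 by apply: valueV.
have dNV : value (- (x`_4 - x`_5))^-1 (- (y`_4 - y`_5))^-1.
  by apply: valueV; [apply: valueN | rewrite oppr_eq0].
by case=> [|[|[|[|[|[|i]]]]]]; rewrite /turn /= ?nth_nil; last exact: value0;
  apply: valueM => //; apply: valueB.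
Qed.

Lemma value_pi1_gauge : y`_4 - 1 != 0 -> value (pi1_gauge x) (pi1_gauge y).
Proof.
have V1 := value1 phi.
move=> t1; apply: valueM; last by apply: valueV => //; apply: valueB.
by apply: valueM => //; apply: valueB.
Qed.

Lemma value_pi3_gauge : y`_4 != 0 -> value (pi3_gauge x) (pi3_gauge y).
Proof. by move=> t0; apply: valueM; [apply: valueX | apply: valueV]. Qed.

Lemma value_pi3_inv_den : value (pi3_inv_den x) (pi3_inv_den y).
Proof.
have V1 := value1 phi.
apply: valueB => //; apply: valueM => //; apply: valueD => //.
by apply: valueB => //; apply: valueX.
Qed.

Lemma value_pi3_inv_gauge :
  pi3_inv_den y != 0 -> value (pi3_inv_gauge x) (pi3_inv_gauge y).
Proof.
move=> d0; apply: valueM; last exact/valueV/d0/value_pi3_inv_den.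
by apply: valueM => //; apply: valueX.
Qed.

End ValueMaps.

(** * Composition of transformations and pullback of forms *)

Lemma value_comp (R : idomainType) (L L' : fieldType) (phi : {rmorphism R -> L})
    (psi : {rmorphism R -> L'}) (sigma : {rmorphism L -> L'}) f v :
  (forall p, psi p = sigma (phi p)) -> value phi f v -> value psi f (sigma v).
Proof.
move=> psiE [n [d [d0 fE vE]]]; exists n, d.
by rewrite !psiE -vE rmorphM fmorph_eq0.
Qed.

Section Transformations.
Variable C : fieldType.
Local Notation K := (ratfun C).
Implicit Types (F G : 6.-tuple K) (al be : 7.-tuple C) (f g h : transf C).

Lemma evalmap_coords p : evalmap (coords C) p = tofrac p.
Proof.
elim/mpoly_ring_ind: p => [c|i|p q Pp Pq|p q Pp Pq].
- by rewrite /= mmapC.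
- by rewrite /= mmapX mmap1U coordsE.
- by rewrite !rmorphD Pp Pq.
- by rewrite !rmorphM Pp Pq.
Qed.

Lemma dominant_coords : dominant (coords C).
Proof. by split=> p p0; rewrite evalmap_coords tofrac_eq0. Qed.

Lemma subst_coords_id (u : K) : subst (coords C) u = u.
Proof.
apply: (subst_unique dominant_coords); exists \n_(repr u), \d_(repr u).
by rewrite !evalmap_coords tofrac_eq0 denom_ratioP numden_tofrac.
Qed.

Definition comp_map F G := map_tuple (subst F) G.

Lemma evalmap_comp F G p : dominant F ->
  evalmap (comp_map F G) p = subst F (evalmap G p).
Proof.
move=> domF; pose sigma := subst_morphism domF; rewrite -[subst F]/(sigma : K -> K).
elim/mpoly_ring_ind: p => [c|i|p q Pp Pq|p q Pp Pq].
- by rewrite /= !mmapC /= subst_cst.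
- by rewrite /= !mmapX !mmap1U tnth_map.
- by rewrite !rmorphD Pp Pq.
- by rewrite !rmorphM Pp Pq.
Qed.

Lemma subst_neq0 F (u : K) : dominant F -> u != 0 -> subst F u != 0.
Proof.
move=> domF u0; rewrite -[subst F]/(subst_morphism domF : K -> K).
by rewrite fmorph_eq0.
Qed.

Lemma dominant_comp F G : dominant F -> dominant G -> dominant (comp_map F G).
Proof.
move=> domF domG; split=> p p0; rewrite evalmap_comp //.
exact/subst_neq0/(evalmap_neq0 domG).
Qed.

Lemma subst_comp F G (u : K) : dominant F -> dominant G ->
  subst (comp_map F G) u = subst F (subst G u).
Proof.
move=> domF domG; apply: (subst_unique (dominant_comp domF domG)).
apply: (value_comp (sigma := subst_morphism domF)) (subst_value u domG).
by move=> p; apply: evalmap_comp.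
Qed.

Lemma comp_mapA F G H : dominant F -> dominant G ->
  comp_map F (comp_map G H) = comp_map (comp_map F G) H.
Proof.
by move=> domF domG; apply: eq_from_tnth => i; rewrite !tnth_map subst_comp.
Qed.

Lemma comp_map_idl F : comp_map (coords C) F = F.
Proof. by apply: eq_from_tnth => i; rewrite tnth_map subst_coords_id. Qed.

Lemma subst_tnth_coords F i : dominant F -> subst F (tnth (coords C) i) = tnth F i.
Proof.
move=> domF; rewrite coordsE -[i in LHS]inord_val.
by rewrite (subst_coord (k := i)) // (tnth_nth 0).
Qed.

Lemma comp_map_idr F : dominant F -> comp_map F (coords C) = F.
Proof.
by move=> domF; apply: eq_from_tnth => i; rewrite tnth_map subst_tnth_coords.
Qed.

Lemma comptE f g al :
  compt f g al = (comp_map (f al).1 (g (f al).2).1, (g (f al).2).2).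
Proof. by rewrite /compt; case: (f al) => F be /=; case: (g be). Qed.

Definition admissible f := forall al, normalized al ->
  normalized (f al).2 /\ dominant (f al).1.

Lemma admissible_id : admissible (@idt C).
Proof. by move=> al; split=> //; apply: dominant_coords. Qed.

Lemma admissible_comp f g : admissible f -> admissible g -> admissible (compt f g).
Proof.
move=> okf okg al nal; have [nbe domF] := okf al nal; have [nga domG] := okg _ nbe.
by rewrite comptE; split=> //; apply: dominant_comp.
Qed.

Lemma eqt_refl f : eqt f f. Proof. by []. Qed.

Lemma eqt_sym f g : eqt f g -> eqt g f.
Proof. by move=> fg al nal; rewrite fg. Qed.

Lemma eqt_trans f g h : eqt f g -> eqt g h -> eqt f h.
Proof. by move=> fg gh al nal; rewrite fg ?gh. Qed.

Lemma eqt_compt f f' g g' : admissible f -> eqt f f' -> eqt g g' ->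
  eqt (compt f g) (compt f' g').
Proof.
move=> okf ff' gg' al nal; have [nbe _] := okf al nal.
by rewrite !comptE -ff' // -gg'.
Qed.

Lemma comptA f g h : admissible f -> admissible g ->
  eqt (compt f (compt g h)) (compt (compt f g) h).
Proof.
move=> okf okg al nal; have [nbe domF] := okf al nal.
by have [_ domG] := okg _ nbe; rewrite !comptE /= comp_mapA.
Qed.

Lemma compt_idl f : eqt (compt (@idt C) f) f.
Proof. by move=> al _; rewrite comptE /= comp_map_idl; case: (f al). Qed.

Lemma compt_idr f : admissible f -> eqt (compt f (@idt C)) f.
Proof.
move=> okf al nal; have [_ domF] := okf al nal.
by rewrite comptE /= comp_map_idr //; case: (f al).
Qed.

Lemma pullback_mul m m' F (M : 'M[K]_(m, m')) w : dominant F ->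
  pullback F (M *m w) = map_mx (subst F) M *m pullback F w.
Proof.
move=> domF; rewrite /pullback -[subst F]/(subst_morphism domF : K -> K).
by rewrite map_mxM mulmxA.
Qed.

(** This is the chain rule. *)
Lemma pullback_comp m F G (w : 'M[K]_(m, 6)) : dominant F -> dominant G ->
  pullback (comp_map F G) w = pullback F (pullback G w).
Proof.
move=> domF domG; rewrite [pullback G w]/pullback pullback_mul // /pullback.
congr (_ *m _); first by apply/matrixP => i j; rewrite !mxE subst_comp.
apply/matrixP => i j; rewrite !mxE tnth_map.
rewrite (subst_chain_rule domF (@partial_derivation C j)).
by apply: eq_bigr => k _; rewrite !mxE.
Qed.

Lemma pullback_id m (w : 'M[K]_(m, 6)) : pullback (coords C) w = w.
Proof.
rewrite /pullback (_ : \matrix_(j < 6) _ = 1%:M) ?mulmx1.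
  by apply/matrixP => i j; rewrite mxE subst_coords_id.
by apply/matrixP => i j; rewrite !mxE partial_coord eq_sym.
Qed.

Lemma pullback_submx m m' F (v : 'M[K]_(m, 6)) (w : 'M[K]_(m', 6)) :
  dominant F -> (v <= w)%MS -> (pullback F v <= pullback F w)%MS.
Proof.
by move=> domF /submxP[M ->]; rewrite pullback_mul //; apply: submxMl.
Qed.

(** Only one inclusion between the spans; for a transformation with an inverse of
    the same kind the other one follows, see inverse_symmetries_backlund. *)
Definition symmetry f := admissible f /\ forall al, normalized al ->
  (pullback (f al).1 (system (f al).2) <= system al)%MS.

Lemma symmetry_id : symmetry (@idt C).
Proof.
by split=> [|al nal]; [apply: admissible_id | rewrite /= pullback_id].
Qed.

Lemma symmetry_comp f g : symmetry f -> symmetry g -> symmetry (compt f g).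
Proof.
move=> [okf sf] [okg sg]; split=> [|al nal]; first exact: admissible_comp.
have [nbe domF] := okf al nal; have [_ domG] := okg _ nbe.
rewrite comptE /= pullback_comp //.
by apply: submx_trans (sf al nal); apply/pullback_submx/sg.
Qed.

Definition inverse_symmetries f g :=
  [/\ symmetry f, symmetry g, eqt (compt f g) (@idt C) & eqt (compt g f) (@idt C)].

Lemma inverse_symmetries_id : inverse_symmetries (@idt C) (@idt C).
Proof. by split; [apply: symmetry_id.. | apply: compt_idl | apply: compt_idl]. Qed.

Lemma eqt_cancel f f' g g' : admissible f -> admissible f' ->
    admissible g -> admissible g' ->
  eqt (compt f f') (@idt C) -> eqt (compt g g') (@idt C) ->
  eqt (compt (compt f g) (compt g' f')) (@idt C).
Proof.
move=> okf okf' okg okg' ff' gg'.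
apply: eqt_trans (eqt_sym (comptA _ okf okg)) _.
apply: eqt_trans _ ff'; apply: eqt_compt => //.
apply: eqt_trans (comptA _ okg okg') _.
apply: eqt_trans (compt_idl _); apply: eqt_compt => //; exact: admissible_comp.
Qed.

Lemma inverse_symmetries_comp f f' g g' :
    inverse_symmetries f f' -> inverse_symmetries g g' ->
  inverse_symmetries (compt f g) (compt g' f').
Proof.
move=> [sf sf' ff' f'f] [sg sg' gg' g'g].
split; [exact: symmetry_comp | exact: symmetry_comp | |];
  apply: eqt_cancel => //; by case: sf sf' sg sg' => ? _ [? _] [? _] [? _].
Qed.

(** Pulling back along f the inclusion that holds for the inverse g gives the
    missing inclusion, since the pullback along g followed by the pullback along
    f is the identity. *)
Lemma inverse_symmetries_backlund f g : inverse_symmetries f g -> backlund f.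
Proof.
case=> [[okf sf] [okg sg] fg gf]; split.
  split=> [al nal|]; first by case: (okf al nal).
  by exists g; split=> // al nal; case: (okg al nal).
move=> al nal; rewrite sf // andTb; have [nbe domF] := okf al nal.
have [_ domG] := okg _ nbe; have := fg al nal.
rewrite comptE /idt => -[FG ga].
rewrite -{1}[system al]pullback_id -[coords C]/[tuple q1; p1; q2; p2; t; s].
have <- : comp_map (f al).1 (g (f al).2).1 = [tuple q1; p1; q2; p2; t; s].
  exact: val_inj.
rewrite pullback_comp //; apply: pullback_submx => //.
by have := sg _ nbe; rewrite ga.
Qed.

End Transformations.

(** * From preserved solutions to pulled back forms *)

Section HamiltonianField.
Variable L : fieldType.
Implicit Types (x a : seq L).

Definition H1_field x a : seq L := [:: Hp1 x a; - Hq1 x a; Hp2 x a; - Hq2 x a].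
Definition H2_field x a : seq L := H1_field (swap_times x) (swap_params a).

Lemma flow_field D x a r : flow D x a -> (r < 4)%N ->
  D x`_r = (H1_field x a)`_r * D x`_4 + (H2_field x a)`_r * D x`_5.
Proof.
case=> E0 E1 E2 E3; case: r => [|[|[|[|//]]]] _; rewrite ?(E0, E1, E2, E3) //=;
  by rewrite !mulNr opprD.
Qed.

Lemma field_flow D x a :
    (forall r, (r < 4)%N ->
      D x`_r = (H1_field x a)`_r * D x`_4 + (H2_field x a)`_r * D x`_5) ->
  flow D x a.
Proof. by move=> E; split; rewrite E //= !mulNr -opprD. Qed.

Lemma derivation_H1 D x a :
    (forall f g, D (f + g) = D f + D g) ->
    (forall f g, D (f * g) = D f * g + f * D g) ->
    D x`_4 = 0 -> D x`_5 = 0 -> (forall i, D a`_i = 0) ->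
    times_ok x -> sum_params a = 1 ->
  D (H1 x`_0 x`_1 x`_2 x`_3 x`_4 x`_5 a`_0 a`_1 a`_2 a`_3 a`_4 a`_5 a`_6) =
  Hq1 x a * D x`_0 + Hp1 x a * D x`_1 + Hq2 x a * D x`_2 + Hp2 x a * D x`_3.
Proof.
move=> DD DM Dt Ds Da /and5P[t0 t1 s0 s1 ts] a1.
rewrite /H1 -/(sum_params a) a1 /HVI !expr2.
rewrite !(DD, DM, DN DD DM, DV DM, D1 DM) Dt Ds !Da.
rewrite /Hq1 /Hp1 /Hq2 /Hp2 /HVIq /HVIp.
by field; rewrite t0 t1 ts.
Qed.

Lemma sum_pick (A B A' B' : L) k : (k < 4)%N ->
  A * (k == 0)%:R + B * (k == 1)%:R + A' * (k == 2)%:R + B' * (k == 3)%:R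
  = [:: A; B; A'; B']`_k.
Proof.
by case: k => [|[|[|[|//]]]] _ /=; rewrite !(mulr0, mulr1, addr0, add0r).
Qed.

Lemma times_swap x : times_ok x -> times_ok (swap_times x).
Proof.
case/and5P=> t0 t1 s0 s1 ts; apply/and5P; split=> //=.
by rewrite -opprB oppr_eq0.
Qed.

Lemma sum_swap a : sum_params (swap_params a) = sum_params a.
Proof. by rewrite /sum_params /= [a`_1 + _]addrC. Qed.

End HamiltonianField.

Section Naturality.
Variables (L L' : fieldType) (sigma : {rmorphism L -> L'}).

Let morphE := (rmorphM sigma, rmorphD sigma, rmorphN sigma, rmorph1 sigma).

Lemma HVIp_map q p t eta b1 b2 b3 b4 :
  sigma (HVIp q p t eta b1 b2 b3 b4) =
  HVIp (sigma q) (sigma p) (sigma t) (sigma eta)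
       (sigma b1) (sigma b2) (sigma b3) (sigma b4).
Proof. by rewrite [LHS]fmorph_div !morphE. Qed.

Lemma HVIq_map q p t eta b1 b2 b3 b4 :
  sigma (HVIq q p t eta b1 b2 b3 b4) =
  HVIq (sigma q) (sigma p) (sigma t) (sigma eta)
       (sigma b1) (sigma b2) (sigma b3) (sigma b4).
Proof. by rewrite [LHS]fmorph_div !expr2 !morphE. Qed.

Lemma nth_map_morph (y : seq L) i : (map sigma y)`_i = sigma y`_i.
Proof.
have [iy|yi] := ltnP i (size y); first by rewrite (nth_map 0).
by rewrite !nth_default ?size_map ?rmorph0.
Qed.

Lemma H1_field_map x a :
  map sigma (H1_field x a) = H1_field (map sigma x) (map sigma a).
Proof.
by congr [:: _; _; _; _]; rewrite ?rmorphN /Hp1 /Hq1 /Hp2 /Hq2 rmorphD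
  (HVIp_map, HVIq_map) fmorph_div !morphE !nth_map_morph.
Qed.

End Naturality.

(** The columns of col_mx X 1 span the common kernel of the linear forms given by
    the rows of row_mx 1 (- X). *)
Lemma submx_of_kernel (F : fieldType) m n p (A : 'M[F]_(m, n + p)) X :
  A *m col_mx X 1%:M = 0 -> (A <= row_mx 1%:M (- X))%MS.
Proof.
rewrite -[A]hsubmxK mul_row_col mulmx1 => /eqP; rewrite addrC addr_eq0 => /eqP ->.
by rewrite -{1}[lsubmx A]mulmx1 -mulmxN -mul_mx_row submxMl.
Qed.

Lemma mul_row_1N (F : fieldType) m n p (W : 'M[F]_(n, p)) (Y : 'M_(n + p, m)) :
  row_mx 1%:M (- W) *m Y = usubmx Y - W *m dsubmx Y.
Proof. by rewrite -{1}[Y]vsubmxK mul_row_col mul1mx mulNmx. Qed.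

Section System.
Variable C : fieldType.
Local Notation K := (ratfun C).
Implicit Types (F : 6.-tuple K) (al be : 7.-tuple C).

Definition csts al : seq K := map (@cst C) al.

Lemma cstsE al i : (csts al)`_i = cst al`_i.
Proof.
have [i7|i7] := ltnP i (size al); first by rewrite (nth_map 0).
by rewrite !nth_default ?size_map // rmorph0.
Qed.

Lemma sum_csts al : normalized al -> sum_params (csts al) = 1.
Proof.
move/(congr1 (@cst C)); rewrite rmorph1 => E; rewrite -[RHS]E /sum_params !cstsE.
by rewrite !(rmorphD, rmorphM, rmorph_nat).
Qed.

Hypothesis times_coords : times_ok (coords C).

Lemma partial_coords_nth k l : (k < 6)%N -> (l < 6)%N ->
  partial (inord k) (coords C)`_l = (k == l)%:R.
Proof.
move=> k6 l6; rewrite -(tnth_nth 0 _ (Ordinal l6)) partial_coord.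
by rewrite -val_eqE /= inordK.
Qed.

Lemma partial_csts k al i : partial k (csts al)`_i = 0.
Proof. by rewrite cstsE; case: (@partial_derivation C k) => _ _ ->. Qed.

Lemma partial_H1 (x a : seq K) k : (k < 4)%N ->
    times_ok x -> sum_params a = 1 -> (forall i, partial (inord k) a`_i = 0) ->
    (forall l, (l < 4)%N -> partial (inord k) x`_l = (k == l)%:R) ->
    partial (inord k) x`_4 = 0 -> partial (inord k) x`_5 = 0 ->
  partial (inord k)
    (H1 x`_0 x`_1 x`_2 x`_3 x`_4 x`_5 a`_0 a`_1 a`_2 a`_3 a`_4 a`_5 a`_6) =
  [:: Hq1 x a; Hp1 x a; Hq2 x a; Hp2 x a]`_k.
Proof.
move=> k4 x_ok a1 Da Dx Dt Ds; have [DD DM Dc] := @partial_derivation C (inord k).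
rewrite (derivation_H1 DD DM Dt Ds Da x_ok a1) !Dx //.
exact: sum_pick.
Qed.

Lemma partial_times k l : (k < 4)%N -> (l == 4) || (l == 5) ->
  partial (inord k) (coords C)`_l = 0.
Proof.
move=> k4 l45; rewrite partial_coords_nth.
- by move: k k4 l45 => [|[|[|[|//]]]] _; case/orP => /eqP ->.
- exact: leq_trans k4 _.
- by case/orP: l45 => /eqP ->.
Qed.

Lemma partial_ham1 al k : normalized al -> (k < 4)%N ->
  let x := coords C in let a := csts al in
  partial (inord k) (ham1 al) = [:: Hq1 x a; Hp1 x a; Hq2 x a; Hp2 x a]`_k.
Proof.
move=> nal k4 x a; apply: etrans (partial_H1 k4 times_coords (sum_csts nal) _ _ _ _).
- by rewrite /a !cstsE.
- by move=> i; apply: partial_csts.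
- move=> l l4.
  by apply: partial_coords_nth; [apply: leq_trans k4 _ | apply: leq_trans l4 _].
- exact: partial_times.
- exact: partial_times.
Qed.

Lemma partial_ham2 al k : normalized al -> (k < 4)%N ->
  let x := swap_times (coords C) in let a := swap_params (csts al) in
  partial (inord k) (ham2 al) = [:: Hq1 x a; Hp1 x a; Hq2 x a; Hp2 x a]`_k.
Proof.
move=> nal k4 x a.
have a1 : sum_params a = 1 by rewrite sum_swap sum_csts.
apply: etrans (partial_H1 k4 (times_swap times_coords) a1 _ _ _ _).
- by rewrite /a /= !cstsE.
- have P0 : partial (inord k) (0 : K) = 0.
    rewrite -(rmorph0 (@cst C)).
    by case: (@partial_derivation C (inord k)) => _ _ ->.
  by case=> [|[|[|[|[|[|[|i]]]]]]]; rewrite /a /swap_params /= ?nth_nil;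
    last exact: P0; apply: partial_csts.
- case=> [|[|[|[|//]]]] _; rewrite /swap_times;
    by apply: partial_coords_nth; first exact: leq_trans k4 _.
- by apply: (partial_times (l := 5)).
- by apply: (partial_times (l := 4)).
Qed.

(** The Hamiltonian vector fields of H1 and H2, one per column. *)
Definition velocity al : 'M[K]_(4, 2) :=
  \matrix_(r, c) (if c == ord0 then (H1_field (coords C) (csts al))`_r
                  else (H2_field (coords C) (csts al))`_r).

Lemma dform_coords (i : 'I_6) : dform (tnth (coords C) i) = delta_mx ord0 i.
Proof.
by apply/rowP => j; rewrite !mxE partial_coord eqxx.
Qed.

Lemma scaleNN (U : fieldType) (V : lmodType U) (u v w : V) (b c : U) :
  u + b *: v + c *: w = u - (- b) *: v - (- c) *: w.
Proof. by rewrite !scaleNr !opprK. Qed.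

Lemma row_system al (r : 'I_4) : normalized al ->
  row r (system al) = dform (coords C)`_r
    - (H1_field (coords C) (csts al))`_r *: dform t
    - (H2_field (coords C) (csts al))`_r *: dform s.
Proof.
move=> nal; have h1 := partial_ham1 nal; have h2 := partial_ham2 nal.
rewrite rowK (tnth_nth 0); case: r => [[|[|[|[|//]]]] r4] /=.
- by rewrite /d_p1 (h1 1) ?(h2 1).
- by rewrite /d_q1 (h1 0 isT) (h2 0 isT); apply: scaleNN.
- by rewrite /d_p2 (h1 3) ?(h2 3).
- by rewrite /d_q2 (h1 2 isT) (h2 2 isT); apply: scaleNN.
Qed.

Lemma systemE al : normalized al -> system al = row_mx 1%:M (- velocity al).
Proof.
move=> nal; apply/row_matrixP => r; rewrite row_system //.
have -> : (coords C)`_r = tnth (coords C) (lshift 2 r) by rewrite (tnth_nth 0).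
have -> : t = tnth (coords C) (rshift 4 ord0) by rewrite (tnth_nth 0).
have -> : s = tnth (coords C) (rshift 4 (lift ord0 ord0)) by rewrite (tnth_nth 0).
rewrite !dform_coords; apply/rowP => j; rewrite [RHS]mxE.
case: (@split_ordP 4 2 j) => k ->.
  rewrite (@row_mxEl K 4 4 2) !mxE.
  rewrite (@eq_lshift 4 2) !(@eq_lrshift 4 2).
  by rewrite !eqxx /= !mulr0 !subr0 eq_sym.
rewrite (@row_mxEr K 4 4 2) !mxE.
rewrite (@eq_rlshift 4 2) !(@eq_rshift 4 2); case: k => [[|[|//]] k2] /=.
- by rewrite sub0r mulr0 subr0 mulr1.
- by rewrite sub0r mulr0 oppr0 sub0r mulr1.
Qed.

Lemma map_subst_coords F : dominant F -> map (subst F) (coords C) = F.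
Proof.
by move=> domF; have /(congr1 (@tval _ _)) := comp_map_idr domF.
Qed.

Lemma map_subst_csts F al : dominant F -> map (subst F) (csts al) = csts al.
Proof.
by move=> domF; rewrite -map_comp; apply: eq_map => c /=; apply: subst_cst.
Qed.

Lemma subst_H1_field F al r : dominant F ->
  subst F (H1_field (coords C) (csts al))`_r = (H1_field F (csts al))`_r.
Proof.
move=> domF; pose sigma := subst_morphism domF.
rewrite -[subst F _]/(sigma _) -nth_map_morph H1_field_map.
by rewrite [map sigma (coords C)]map_subst_coords // [map sigma _]map_subst_csts.
Qed.

Lemma subst_H2_field F al r : dominant F ->
  subst F (H2_field (coords C) (csts al))`_r = (H2_field F (csts al))`_r.
Proof.
move=> domF; pose sigma := subst_morphism domF.
rewrite -[subst F _]/(sigma _) -nth_map_morph H1_field_map.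
rewrite -[in RHS](map_subst_coords domF) -[in RHS](map_subst_csts al domF).
by rewrite /H2_field /swap_times /swap_params !(nth_map_morph sigma).
Qed.

(** A pulled back form applied to one of the two vector fields V that annihilate
    the system is the defect of F from being a solution for the derivation V. *)
Lemma pullback_system F al be : dominant F -> normalized al -> normalized be ->
    (forall D : K -> K, derivation_along idfun D ->
      flow D (coords C) (csts al) -> flow D F (csts be)) ->
  (pullback F (system be) <= system al)%MS.
Proof.
move=> domF nal nbe flows; rewrite (systemE nal).
apply: submx_of_kernel; apply/matrixP => r c; rewrite [RHS]mxE.
pose v (j : 'I_6) := (col_mx (velocity al) 1%:M : 'M_(6, 2)) j c.
pose V (f : K) := \sum_j partial j f * v j.
have V_der : derivation_along idfun V.
  split=> [f g|f g|a]; rewrite /V.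
  - rewrite -big_split; apply: eq_bigr => j _ /=.
    by case: (@partial_derivation C j) => -> _ _; rewrite mulrDl.
  - rewrite mulr_suml mulr_sumr -big_split; apply: eq_bigr => j _ /=.
    by case: (@partial_derivation C j) => _ -> _ /=; ring.
  - rewrite big1 // => j _; case: (@partial_derivation C j) => _ _ ->.
    by rewrite mul0r.
have V_coords i : V (tnth (coords C) i) = v i.
  rewrite /V (bigD1 i) //= partial_coord eqxx mul1r big1 ?addr0 // => j ji.
  by rewrite partial_coord (negPf ji) mul0r.
(* The two columns are d/dt + X_H1 and d/ds + X_H2, hence V t and V s are 0 or 1. *)
have v_time k : v (rshift 4 k) = (k == c)%:R.
  by rewrite /v (@col_mxEd K 4 2 2) mxE.
have flV : flow V (coords C) (csts al).
  apply: field_flow => k k4.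
  rewrite -(tnth_nth 0 _ (lshift 2 (Ordinal k4))) -(tnth_nth 0 _ (rshift 4 ord0)).
  rewrite -(tnth_nth 0 _ (rshift 4 (lift ord0 ord0))) !V_coords !v_time.
  rewrite /v (@col_mxEu K 4 2 2) mxE.
  by case: (c) => [[|[|//]] c2] /=; rewrite ?mulr1 ?mulr0 ?addr0 ?add0r.
have flF := flow_field (flows V V_der flV) (ltn_ord r).
pose sigma := subst_morphism domF.
pose Y : 'M[K]_(4 + 2, 2) :=
  (\matrix_(j < 6) dform (tnth F j)) *m col_mx (velocity al) 1%:M.
have YE k : Y k c = V (tnth F k).
  by rewrite /Y mxE; apply: eq_bigr => j _; rewrite mxE mxE.
rewrite /pullback -mulmxA -/Y (systemE nbe) -[subst F]/(sigma : K -> K).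
have -> : map_mx sigma (row_mx 1%:M (- velocity be)) =
    row_mx 1%:M (- map_mx sigma (velocity be)).
  by rewrite (@map_row_mx _ _ _ 4 4 2) map_mx1 map_mxN.
transitivity ((usubmx Y - map_mx sigma (velocity be) *m dsubmx Y) r c).
  by congr (fun_of_matrix _ r c); apply: mul_row_1N.
clearbody Y; rewrite !mxE !big_ord_recl big_ord0 !mxE !YE !(tnth_nth 0).
rewrite [sigma _](subst_H1_field _ _ domF) [sigma _](subst_H2_field _ _ domF).
by rewrite addr0 [X in X - _]flF subrr.
Qed.

End System.

(** * Nonvanishing at the generic point *)

Section ValueNonzero.
Variables (R : idomainType) (L : fieldType) (phi : {rmorphism R -> L}).
Local Notation value := (value phi).
Variables (x : seq {fraction R}) (y : seq L).
Hypotheses (xy : forall i, value x`_i y`_i).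

Lemma value_mirror k : value (mirror k x) (mirror k y).
Proof.
case: k => [|[|[|[|[|[|[|k]]]]]]]; rewrite /mirror /= ?nth_nil //;
  by [apply: valueB | apply: valueB (value1 _) | apply: value0].
Qed.

Lemma value_times_ok : times_ok y -> times_ok x.
Proof.
have V1 := value1 phi.
case/and5P => t0 t1 s0 s1 ts; apply/and5P; split.
- exact: value_neq0 (xy 4) t0.
- by apply: value_neq0 t1; apply: valueB.
- exact: value_neq0 (xy 5) s0.
- by apply: value_neq0 s1; apply: valueB.
- by apply: value_neq0 ts; apply: valueB.
Qed.

Lemma value_gauge_ok e e' : value e e' -> gauge_ok e' y -> gauge_ok e x.
Proof.
move=> ee'; have MV i : value ((1 - e) * x`_i + e) ((1 - e') * y`_i + e').
  apply: valueD => //; apply: valueM => //; apply: valueB => //; exact: value1.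
case/and5P => e0 M0 M2 M4 M5; apply/and5P; split.
- exact: value_neq0 ee' e0.
- exact: value_neq0 (MV 0) M0.
- exact: value_neq0 (MV 2) M2.
- exact: value_neq0 (MV 4) M4.
- exact: value_neq0 (MV 5) M5.
Qed.
End ValueNonzero.

Section NonVanishing.
Variable C : numFieldType.
Local Notation K := (ratfun C).

Lemma value_coords_point (u : 6.-tuple C) i : value (evalpoint u) (coords C)`_i u`_i.
Proof.
have [i6|i6] := ltnP i 6; last by rewrite !nth_default ?size_tuple //; apply: value0.
by case: i i6 => [|[|[|[|[|[|//]]]]]] _; apply: value_coord_point.
Qed.

Lemma ratio_neq0 n m (z : C) : (0 < n)%N -> (0 < m)%N -> z * m%:R = n%:R -> z != 0.
Proof.
move=> n0 m0 zE; have : z * m%:R != 0 by rewrite zE pnatr_eq0 -lt0n.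
by rewrite mulf_eq0 negb_or => /andP[].
Qed.

Lemma nat_neq0 n : (0 < n)%N -> n%:R != 0 :> C.
Proof. by rewrite pnatr_eq0 -lt0n. Qed.

Ltac num n m := solve [apply: (@ratio_neq0 n%N m%N) => //; ring].
Ltac opp_num n m :=
  solve [rewrite -oppr_eq0; apply: (@ratio_neq0 n%N m%N) => //; ring].

(** Integer points at which the required denominators do not vanish; a rational
    function with a nonzero value somewhere is nonzero. *)
Definition point1 : 6.-tuple C := [tuple 1; 1; 1; 1; 2; - 1].
Definition point2 : 6.-tuple C := [tuple 5; 1; 2; 1; 3; 1].

Lemma times_coords : times_ok (coords C).
Proof.
apply: (value_times_ok (value_coords_point point1)); apply/and5P; split => /=.
- num 2%N 1%N.
- num 1%N 1%N.
- opp_num 1%N 1%N.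
- opp_num 2%N 1%N.
- num 3%N 1%N.
Qed.

Lemma mirror_coords k : (k < 7)%N -> mirror k (coords C) != 0.
Proof.
move=> k7; apply: value_neq0 (value_mirror (value_coords_point point2) k) _.
case: k k7 => [|[|[|[|[|[|[|//]]]]]]] _; rewrite /mirror /=;
  first [num 1%N 1%N | num 2%N 1%N | num 3%N 1%N | num 4%N 1%N].
Qed.

Lemma pi1_gauge_coords : gauge_ok (pi1_gauge (coords C)) (swap_times (coords C)).
Proof.
have e4 : pi1_gauge point1 = 4 by rewrite /pi1_gauge /=; field.
have V i :
    value (evalpoint point1) (swap_times (coords C))`_i (swap_times point1)`_i.
  exact: value_swap (value_coords_point point1) i.
have eV : value (evalpoint point1) (pi1_gauge (coords C)) 4.
  rewrite -e4; apply: value_pi1_gauge; first exact: value_coords_point.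
  by rewrite /=; num 1%N 1%N.
apply: (value_gauge_ok V eV); apply/and5P; split => /=.
- num 4%N 1%N.
- num 1%N 1%N.
- num 1%N 1%N.
- num 7%N 1%N.
- opp_num 2%N 1%N.
Qed.

Ltac frac_num n m := solve [apply: (@ratio_neq0 n%N m%N) => //; field => //].
Ltac opp_frac_num n m :=
  solve [rewrite -oppr_eq0; apply: (@ratio_neq0 n%N m%N) => //; field => //].

Lemma pi3_gauge_coords : gauge_ok (pi3_gauge (coords C)) (turn (coords C)).
Proof.
have n2 := @nat_neq0 2 isT; have n3 := @nat_neq0 3 isT.
have ts : point1`_4 - point1`_5 != 0 by rewrite /=; num 3%N 1%N.
have V := value_turn (value_coords_point point1) ts.
have eV : value (evalpoint point1) (pi3_gauge (coords C)) 2^-1.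
  rewrite (_ : 2^-1 = pi3_gauge point1); last by rewrite /pi3_gauge /=; field.
  by apply: value_pi3_gauge; [exact: value_coords_point | rewrite /=; num 2%N 1%N].
have o3 : 1 - -2 != 0 :> C by num 3%N 1%N.
have turnE : turn point1 = [:: 2 / 3; 3; 2 / 3; 3; 2 / 3; 1 / 3].
  rewrite /turn /=; do ?congr (_ :: _); try (field => //; num 3%N 1%N); ring.
apply: (value_gauge_ok V eV); rewrite turnE; apply/and5P; split => /=.
- by rewrite invr_neq0.
- frac_num 5%N 6%N.
- frac_num 5%N 6%N.
- frac_num 5%N 6%N.
- frac_num 2%N 3%N.
Qed.

Lemma pi3_inv_den_coords : pi3_inv_den (coords C) != 0.
Proof.
apply: value_neq0 (value_pi3_inv_den (value_coords_point point1)) _.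
by rewrite /pi3_inv_den /=; num 7%N 1%N.
Qed.

Lemma pi3_inv_gauge_coords : gauge_ok (pi3_inv_gauge (coords C)) (coords C).
Proof.
have n7 := @nat_neq0 7 isT.
have d7 : pi3_inv_den point1 = 7 by rewrite /pi3_inv_den /=; ring.
have eV : value (evalpoint point1) (pi3_inv_gauge (coords C)) (2 / 7).
  rewrite (_ : 2 / 7 = pi3_inv_gauge point1);
    last by rewrite /pi3_inv_gauge d7 /=; field.
  by apply: value_pi3_inv_gauge; [exact: value_coords_point | rewrite d7].
apply: (value_gauge_ok (value_coords_point point1) eV); apply/and5P; split => /=.
- frac_num 2%N 7%N.
- frac_num 1%N 1%N.
- frac_num 1%N 1%N.
- frac_num 12%N 7%N.
- opp_frac_num 3%N 7%N.
Qed.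

End NonVanishing.

(** * The generators *)

Lemma shear_table (L : fieldType) k (x a : seq L) : (k < 7)%N -> shear k x a =
  nth [::]
    [:: [:: x`_0; x`_1 - a`_0 / (x`_0 - x`_4); x`_2; x`_3; x`_4; x`_5];
        [:: x`_0; x`_1 - a`_1 / (x`_0 - x`_5); x`_2; x`_3; x`_4; x`_5];
        [:: x`_0 + a`_2 / x`_1; x`_1; x`_2; x`_3; x`_4; x`_5];
        [:: x`_0; x`_1 - a`_3 / (x`_0 - x`_2);
            x`_2; x`_3 + a`_3 / (x`_0 - x`_2); x`_4; x`_5];
        [:: x`_0; x`_1; x`_2 + a`_4 / x`_3; x`_3; x`_4; x`_5];
        [:: x`_0; x`_1; x`_2; x`_3 - a`_5 / (x`_2 - 1); x`_4; x`_5];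
        [:: x`_0; x`_1; x`_2; x`_3 - a`_6 / x`_2; x`_4; x`_5]] k.
Proof.
by case: k => [|[|[|[|[|[|[|//]]]]]]] _;
  rewrite /shear /mkseq /mirror /direction /= !(mulr0, addr0, mulrN1, mulr1).
Qed.

Section Tables.
Variable L : fieldType.
Implicit Types (x a : seq L).

Lemma gauge_ok_swap e x : gauge_ok e (swap_times x) -> gauge_ok e x.
Proof. by case/and5P=> ? ? ? ? ?; apply/and5P; split. Qed.

Lemma pi1_point_table x a : times_ok x -> gauge_ok (pi1_gauge x) (swap_times x) ->
  let t := x`_4 in let s := x`_5 in
  let Q q := (t - 1) * q / (t - q - t * s + t * s * q) in
  let P q p b := (- t + q + t * s - t * s * q)
    * (t * p - q * p - b - t * s * p + t * s * q * p + b * t * s)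
    / (t * (t - 1) * (s - 1)) in
  pi1_point x a = [:: Q x`_0; P x`_0 x`_1 a`_2; Q x`_2; P x`_2 x`_3 a`_4;
                 s * (t - 1) / (t - s - t * s + t * s ^+ 2); 1 / s].
Proof.
move=> x_ok g_ok t s Q P; move: x_ok g_ok.
rewrite /times_ok /gauge_ok /= -/t -/s.
case/and5P => t0 t1 s0 s1 ts /and5P[_ q1M q2M sM tM].
have s1' : 1 - s != 0 by nonzero.
have e0E : pi1_gauge x = t * (1 - s) / (t - 1) by [].
set e := pi1_gauge x in q1M q2M sM tM e0E *.
have ME q : (1 - e) * q + e = (t - q - t * s + t * s * q) / (t - 1).
  by rewrite e0E; field.
have {}M q : (1 - e) * q + e != 0 -> t - q - t * s + t * s * q != 0.
  by rewrite ME mulf_eq0 negb_or => /andP[].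
have QE q : (1 - e) * q + e != 0 -> q / ((1 - e) * q + e) = Q q.
  by move=> /M Mq; rewrite ME /Q; field; rewrite t1 Mq.
have PE q p b :
    ((1 - e) * q + e) * (((1 - e) * q + e) * p + (1 - e) * b) / e = P q p b.
  by rewrite ME e0E /P; field; do ?[apply/andP; split]; nonzero.
rewrite /pi1_point /gauge /= -/t -/s -/e.
congr [:: _; _; _; _; _; _]; rewrite ?QE ?PE //.
- by rewrite /Q; congr (_ / _); ring.
- have ts1 := mulf_neq0 (mulf_neq0 t0 s0) t1.
  by rewrite /Q; field; do ?[apply/andP; split]; nonzero.
Qed.

Lemma pi3_point_table x a : times_ok x -> gauge_ok (pi3_gauge x) (turn x) ->
  let t := x`_4 in let s := x`_5 in
  let D q := t * (q - s) + s ^+ 2 * (t - q) in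
  let Q q := t * (q - s) / D q in
  let P q p b := D q * (t * (q - s) * p + b * (t - s ^+ 2) + s ^+ 2 * (t - q) * p)
    / (t * s ^+ 2 * (t - s)) in
  pi3_point x a = [:: Q x`_2; P x`_2 x`_3 a`_4; Q x`_0; P x`_0 x`_1 a`_2;
    - ((s - 1) * t / (t - t * s + s ^+ 2 * (t - 1))); - (1 / (s - 1))].
Proof.
move=> x_ok g_ok t s D Q P; move: x_ok g_ok.
rewrite /times_ok /gauge_ok /= -/t -/s.
case/and5P => t0 t1 s0 s1 ts /and5P[_ q1M q2M sM _].
have s1' : 1 - s != 0 by nonzero.
have e0E : pi3_gauge x = s ^+ 2 / t by [].
set e := pi3_gauge x in q1M q2M sM e0E *.
have ME q : (1 - e) * ((q - s) / (t - s)) + e = D q / (t * (t - s)).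
  by rewrite e0E /D; field; do ?[apply/andP; split]; nonzero.
have {}M q : (1 - e) * ((q - s) / (t - s)) + e != 0 -> D q != 0.
  by rewrite ME mulf_eq0 negb_or => /andP[].
have QE q : (1 - e) * ((q - s) / (t - s)) + e != 0 ->
    (q - s) / (t - s) / ((1 - e) * ((q - s) / (t - s)) + e) = Q q.
  by move=> /M Mq; rewrite ME /Q; field; do ?[apply/andP; split]; nonzero.
have PE q p b : ((1 - e) * ((q - s) / (t - s)) + e) *
    (((1 - e) * ((q - s) / (t - s)) + e) * ((t - s) * p) + (1 - e) * b)
    / e = P q p b.
  by rewrite ME e0E /P /D; field; do ?[apply/andP; split]; nonzero.
rewrite /pi3_point /gauge /= -/t -/s -/e.
congr [:: _; _; _; _; _; _]; rewrite ?QE ?PE //.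
- have D1 := M _ sM; rewrite /D in D1; rewrite /Q /D.
  by field; do ?[apply/andP; split]; nonzero.
- have tss := mulf_neq0 t0 (mulf_neq0 s0 s1').
  rewrite e0E; have st : s - t != 0 by nonzero.
  have tsst := mulf_neq0 ts tss.
  by field; do ?[apply/andP; split]; nonzero.
Qed.

Lemma times_turn x : times_ok x -> times_ok (turn x).
Proof.
case/and5P => t0 t1 s0 s1 ts; rewrite /times_ok /turn /=.
have s1' : 1 - x`_5 != 0 by nonzero.
have t1' : 1 - x`_4 != 0 by nonzero.
rewrite (_ : (1 - x`_5) / (x`_4 - x`_5) - 1 = (1 - x`_4) / (x`_4 - x`_5));
  last by field.
rewrite (_ : x`_5 / - (x`_4 - x`_5) - 1 = - x`_4 / (x`_4 - x`_5));
  last by field; do ?[apply/andP; split]; nonzero.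
rewrite (_ : (1 - x`_5) / (x`_4 - x`_5) - x`_5 / - (x`_4 - x`_5) = (x`_4 - x`_5)^-1);
  last by field; do ?[apply/andP; split]; nonzero.
by rewrite !(mulf_neq0, invr_neq0, oppr_eq0).
Qed.

Lemma times_gauge e x a : times_ok x -> gauge_ok e x -> times_ok (gauge e x a).
Proof.
case/and5P => t0 t1 s0 s1 ts /and5P[e0 _ _ tM sM]; rewrite /times_ok /gauge /=.
have Q1 q : (1 - e) * q + e != 0 ->
    q / ((1 - e) * q + e) - 1 = e * (q - 1) / ((1 - e) * q + e).
  by move=> Mq; field.
rewrite !Q1 // (_ : x`_4 / ((1 - e) * x`_4 + e) - x`_5 / ((1 - e) * x`_5 + e) =
    e * (x`_4 - x`_5) / (((1 - e) * x`_4 + e) * ((1 - e) * x`_5 + e)));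
  last by field; rewrite tM sM.
by rewrite !(mulf_neq0, invr_neq0).
Qed.

End Tables.

Section Generators.
Variable C : numFieldType.
Local Notation K := (ratfun C).
Implicit Types (al be : 7.-tuple C) (f g : transf C).

Definition preserves_flow f := forall al, normalized al ->
  forall D : K -> K, derivation_along idfun D ->
  flow D (coords C) (csts al) -> flow D (f al).1 (csts (f al).2).

(** The equation between F = (f al).1 and G = (g (f al).2).1 is an evaluation of G
    at F rather than a substitution: it makes sense before F is known to be
    dominant, and for the pair g, f it implies that F is. *)
Definition left_inverse_of f g := forall al, normalized al ->
  [/\ normalized (f al).2, (g (f al).2).2 = al &
      forall i, value (evalmap (f al).1) ((g (f al).2).1)`_i (coords C)`_i].

Lemma inverse_symmetriesP f g :
    left_inverse_of f g -> left_inverse_of g f ->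
    preserves_flow f -> preserves_flow g ->
  inverse_symmetries f g.
Proof.
have sym f1 g1 : left_inverse_of f1 g1 -> left_inverse_of g1 f1 ->
    preserves_flow f1 -> symmetry f1 /\ eqt (compt f1 g1) (@idt C).
  move=> fg gf flows.
  have ok : admissible f1.
    move=> al nal; have [nbe ga _] := fg al nal; split=> //.
    have [_ _ vals] := gf _ nbe; rewrite ga in vals.
    by apply: dominant_left_inverse => i; rewrite !(tnth_nth 0); apply: vals.
  split.
    split=> // al nal; have [nbe domF] := ok al nal.
    by apply: pullback_system => //; [exact: times_coords | exact: flows].
  move=> al nal; have [nbe domF] := ok al nal; have [_ ga vals] := fg al nal.
  rewrite comptE ga; congr pair; apply: eq_from_tnth => i.
  rewrite tnth_map; apply: (subst_unique domF).
  by rewrite !(tnth_nth 0); apply: vals.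
move=> fg gf flf flg.
by have [sf ifg] := sym f g fg gf flf; have [sg igf] := sym g f gf fg flg.
Qed.

Lemma value_coords (F : 6.-tuple K) i : value (evalmap F) (coords C)`_i F`_i.
Proof.
have [i6|i6] := ltnP i 6; last by rewrite !nth_default ?size_tuple //; apply: value0.
by case: i i6 => [|[|[|[|[|[|//]]]]]] _; apply: value_coord.
Qed.

Lemma value_csts (F : 6.-tuple K) al i : value (evalmap F) (csts al)`_i (csts al)`_i.
Proof. by rewrite cstsE; apply: value_cst. Qed.

Lemma csts_reflect (a : seq C) k :
  map (@cst C) (reflect_params k a) = reflect_params k (map (@cst C) a).
Proof.
rewrite /reflect_params /mkseq -map_comp; apply: eq_map => j /=.
by rewrite !nth_map_morph; case: ifP => _; [|case: ifP => _]; rewrite ?rmorphN ?rmorphD.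
Qed.

Lemma sgen_map (k : 'I_7) al :
  (sgen C k al).1 = shear k (coords C) (csts al) :> seq K.
Proof.
rewrite /sgen (tnth_nth (@s0 C)) shear_table // !cstsE.
by case: k => [[|[|[|[|[|[|[|//]]]]]]] k7].
Qed.

Lemma sgen_params (k : 'I_7) al : (sgen C k al).2 = reflect_params k al :> seq C.
Proof.
rewrite /sgen (tnth_nth (@s0 C)).
by case: k => [[|[|[|[|[|[|[|//]]]]]]] k7].
Qed.

Lemma normalizedE al : normalized al <-> sum_params al = 1.
Proof. by []. Qed.

Lemma sum_reflect (L : fieldType) k (a : seq L) : (k < 7)%N ->
  sum_params (reflect_params k a) = sum_params a.
Proof.
by case: k => [|[|[|[|[|[|[|//]]]]]]] _; rewrite /sum_params /reflect_params /=; ring.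
Qed.

Lemma csts_sgen (k : 'I_7) al :
  csts (sgen C k al).2 = reflect_params k (csts al).
Proof. by rewrite -csts_reflect /csts sgen_params. Qed.

Lemma sgen_left_inverse (k : 'I_7) : left_inverse_of (sgen C k) (sgen C k).
Proof.
move=> al nal; split.
- by rewrite normalizedE sgen_params sum_reflect.
- apply: val_inj; rewrite /= !sgen_params reflect_involutive ?size_tuple //.
- move=> i; set F := (sgen C k al).1; set be := (sgen C k al).2.
  have FE : F = shear k (coords C) (csts al) :> seq K := sgen_map k al.
  rewrite sgen_map; apply: value_eq.
    apply: (value_shear (value_coords F) (value_csts F be) (k := k)).
    by rewrite FE shearE mirror_push_self; apply: mirror_coords.
  by rewrite FE /be csts_sgen shear_involutive.
Qed.

Lemma sgen_flow (k : 'I_7) : preserves_flow (sgen C k).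
Proof.
move=> al nal D [DD DM Dc] fl; rewrite sgen_map csts_sgen.
apply: flow_shear => //;
  [exact: times_coords | exact: sum_csts | | exact: mirror_coords].
by move=> i; rewrite cstsE; apply: Dc.
Qed.

Lemma sgen_symmetries (k : 'I_7) : inverse_symmetries (sgen C k) (sgen C k).
Proof.
by apply: inverse_symmetriesP; do 1?[exact: sgen_left_inverse | exact: sgen_flow].
Qed.

Lemma pi1_gauge_coords_swap : gauge_ok (pi1_gauge (coords C)) (coords C).
Proof. exact/gauge_ok_swap/pi1_gauge_coords. Qed.

Lemma pi1_map al : (@pi1 C al).1 = pi1_point (coords C) (csts al) :> seq K.
Proof.
by rewrite pi1_point_table ?times_coords ?pi1_gauge_coords // !cstsE.
Qed.

Lemma pi3_map al : (@pi3 C al).1 = pi3_point (coords C) (csts al) :> seq K.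
Proof.
by rewrite pi3_point_table ?times_coords ?pi3_gauge_coords // !cstsE.
Qed.

Lemma pi2_map al : (@pi2 C al).1 = flip (coords C) :> seq K.
Proof. by []. Qed.

Definition pi3_inv : transf C := fun al =>
  ([tuple of pi3_inv_point (coords C) (csts al)], [tuple of turn_params al]).

Lemma csts_swap al : csts (@pi1 C al).2 = swap_params (csts al).
Proof. by rewrite /swap_params !cstsE. Qed.

Lemma csts_flip al : csts (@pi2 C al).2 = flip_params (csts al).
Proof. by rewrite /flip_params !cstsE. Qed.

Lemma csts_turn al : csts [tuple of turn_params al] = turn_params (csts al).
Proof. by rewrite /turn_params !cstsE. Qed.

Lemma pi3_params al : (@pi3 C al).2 = [tuple of turn_params al].
Proof. exact: val_inj. Qed.

Lemma sum_flip (L : fieldType) (a : seq L) : sum_params (flip_params a) = sum_params a.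
Proof. by rewrite /sum_params /=; ring. Qed.

Lemma sum_turn (L : fieldType) (a : seq L) : sum_params (turn_params a) = sum_params a.
Proof. by rewrite /sum_params /=; ring. Qed.

Lemma times_pair_neq0 : (coords C)`_4 - (coords C)`_5 != 0.
Proof. by case/and5P: (times_coords C). Qed.

Lemma tuple7E al :
  al = [:: al`_0; al`_1; al`_2; al`_3; al`_4; al`_5; al`_6] :> seq C.
Proof. by case: al => [[|? [|? [|? [|? [|? [|? [|? [|? ?]]]]]]]] ?]. Qed.

Lemma pi1_left_inverse : left_inverse_of (@pi1 C) (@pi1 C).
Proof.
move=> al nal; split.
- by rewrite normalizedE sum_swap.
- by apply: val_inj; exact/esym/tuple7E.
move=> i; set F := (pi1 al).1; set be := (pi1 al).2.
have FE : F = pi1_point (coords C) (csts al) :> seq K := pi1_map al.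
have [F4 e1F] := pi1_gauge_inv (csts al) (times_coords C) (pi1_gauge_coords C).
rewrite pi1_map; apply: value_eq.
  apply: (value_gauge (value_swap (value_coords F)) (value_csts F be)).
    by apply: (value_pi1_gauge (value_coords F)); rewrite FE.
  by rewrite FE e1F; apply: gauge_ok_inv pi1_gauge_coords_swap.
rewrite FE /be csts_swap.
by rewrite -[gauge _ _ _]/(pi1_point _ (csts al)) pi1_pointK ?times_coords
  ?pi1_gauge_coords.
Qed.

Lemma pi2_left_inverse : left_inverse_of (@pi2 C) (@pi2 C).
Proof.
move=> al nal; split.
- by rewrite normalizedE sum_flip.
- by apply: val_inj; exact/esym/tuple7E.
move=> i; set F := (pi2 al).1.
rewrite pi2_map; apply: value_eq; first exact: value_flip (value_coords F) i.
by rewrite /F pi2_map flipK.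
Qed.

Lemma pi3_left_inverse : left_inverse_of (@pi3 C) pi3_inv.
Proof.
move=> al nal; split.
- by rewrite pi3_params normalizedE sum_turn.
- by apply: val_inj; exact/esym/tuple7E.
move=> i; set F := (pi3 al).1; set be := (pi3 al).2.
have FE : F = pi3_point (coords C) (csts al) :> seq K := pi3_map al.
have [d0 e3F] := pi3_gauge_inv (csts al) (times_coords C) (pi3_gauge_coords C).
have gF : gauge_ok (pi3_inv_gauge F) F.
  by rewrite FE e3F; apply: gauge_ok_inv; apply: pi3_gauge_coords.
have yE : gauge (pi3_inv_gauge F) F (csts be) = turn (coords C).
  rewrite /be pi3_params csts_turn FE e3F /pi3_point.
  by apply: gaugeK; [exact: (erefl 6) | exact: pi3_gauge_coords | exact: erefl].
apply: value_eq.
  apply: value_turn; first apply: value_gauge gF.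
  - exact: value_coords.
  - exact: value_csts.
  - by apply: value_pi3_inv_gauge; [exact: value_coords | rewrite FE].
  - by rewrite yE; case/and5P: (times_turn (times_coords C)).
rewrite yE; congr (nth 0 _ i).
by apply: turnK; [exact: (erefl 6) | exact: times_pair_neq0].
Qed.

Lemma pi3_inv_left_inverse : left_inverse_of pi3_inv (@pi3 C).
Proof.
move=> al nal; split.
- by rewrite normalizedE sum_turn.
- by apply: val_inj; exact/esym/tuple7E.
move=> i; set F := (pi3_inv al).1; set be := (pi3_inv al).2.
have FE : F = pi3_inv_point (coords C) (csts al) :> seq K by [].
pose y := gauge (pi3_inv_gauge (coords C)) (coords C) (csts al).
have y_ok : times_ok y := times_gauge _ (times_coords C) (pi3_inv_gauge_coords C).
have [y45 F4 e3F] := pi3_inv_gauge_inv (csts al)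
  (times_coords C) (pi3_inv_den_coords C) (pi3_inv_gauge_coords C).
have turnF : turn F = y by rewrite FE; apply: turnK; [exact: (erefl 6) | exact: y45].
rewrite pi3_map /pi3_point -csts_turn; apply: value_eq.
  apply: value_gauge.
  - apply: value_turn; first exact: value_coords.
    by rewrite FE; case/and5P: (times_turn y_ok).
  - exact: value_csts.
  - by apply: value_pi3_gauge; [exact: value_coords | rewrite FE].
  - by rewrite turnF FE e3F; apply: gauge_ok_inv; apply: pi3_inv_gauge_coords.
congr (nth 0 _ i).
rewrite csts_turn -[gauge _ _ _]/(pi3_point F (csts be)) FE csts_turn.
apply: pi3_inv_pointK.
- exact: (erefl 6).
- exact: times_coords.
- exact: pi3_inv_den_coords.
- exact: pi3_inv_gauge_coords.
Qed.

Lemma derivation_csts (D : K -> K) : derivation_along idfun D ->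
  forall al i, D (csts al)`_i = 0.
Proof. by case=> _ _ Dc al i; rewrite cstsE. Qed.

Lemma pi1_flow : preserves_flow (@pi1 C).
Proof.
move=> al nal D Dder fl; have [DD DM _] := Dder.
rewrite pi1_map csts_swap; set a := swap_params _.
rewrite -[pi1_point _ _]/(gauge (pi1_gauge (coords C)) (swap_times (coords C)) a).
apply: (flow_gauge DD DM).
- exact: times_swap (times_coords C).
- by rewrite /a sum_swap; apply: sum_csts.
- by rewrite /a -csts_swap; apply: derivation_csts.
- exact: flow_swap.
- exact: pi1_gauge_coords.
Qed.

Lemma pi2_flow : preserves_flow (@pi2 C).
Proof.
move=> al nal D Dder fl; have [DD DM _] := Dder.
rewrite pi2_map csts_flip.
by apply: (flow_flip DD DM); [exact: times_coords | exact: sum_csts | exact: fl].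
Qed.

Lemma pi3_flow : preserves_flow (@pi3 C).
Proof.
move=> al nal D Dder fl; have [DD DM _] := Dder.
rewrite pi3_map pi3_params csts_turn; apply: (flow_gauge DD DM).
- exact: times_turn (times_coords C).
- by rewrite sum_turn; apply: sum_csts.
- by rewrite -csts_turn; apply: derivation_csts.
- by apply: (flow_turn DD DM); [exact: times_coords | exact: sum_csts | exact: fl].
- exact: pi3_gauge_coords.
Qed.

Lemma pi3_inv_flow : preserves_flow pi3_inv.
Proof.
move=> al nal D Dder fl; have [DD DM _] := Dder.
rewrite csts_turn; apply: (flow_turn DD DM).
- exact: times_gauge (times_coords C) (pi3_inv_gauge_coords C).
- exact: sum_csts.
apply: (flow_gauge DD DM).
- exact: times_coords.
- exact: sum_csts.
- exact: derivation_csts.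
- exact: fl.
- exact: pi3_inv_gauge_coords.
Qed.

Lemma pigen_symmetries (k : 'I_3) :
  exists g, inverse_symmetries (pigen C k) g.
Proof.
rewrite /pigen (tnth_nth (@pi1 C)).
case: k => [[|[|[|//]]] k3] /=; [exists (@pi1 C) | exists (@pi2 C) | exists pi3_inv];
  apply: inverse_symmetriesP.
- exact: pi1_left_inverse.
- exact: pi1_left_inverse.
- exact: pi1_flow.
- exact: pi1_flow.
- exact: pi2_left_inverse.
- exact: pi2_left_inverse.
- exact: pi2_flow.
- exact: pi2_flow.
- exact: pi3_left_inverse.
- exact: pi3_inv_left_inverse.
- exact: pi3_flow.
- exact: pi3_inv_flow.
Qed.

Lemma composite_symmetries (I : Type) (h : I -> transf C) (w : seq I) :
    (forall i, exists g, inverse_symmetries (h i) g) ->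
  exists g, inverse_symmetries (composite (map h w)) g.
Proof.
move=> hinv; elim: w => [|i w [g wg]].
  by exists (@idt C); apply: inverse_symmetries_id.
have [g' hg'] := hinv i; exists (compt g g').
exact: inverse_symmetries_comp hg' wg.
Qed.

End Generators.

(** * Words and the root lattice *)

Section WeylWords.
Implicit Types (u v w : seq 'I_7) (i j : 'I_7).

Lemma weyl_cat v v' w w' :
  weyl_eq v v' -> weyl_eq w w' -> weyl_eq (v ++ w) (v' ++ w').
Proof.
move=> vv' ww'; apply: (@weyl_trans _ (v' ++ w)).
  by have := weyl_ctx [::] w vv'.
by have := weyl_ctx v' [::] ww'; rewrite !cats0.
Qed.

Lemma weyl_cat_rev w : weyl_eq (w ++ rev w) [::].
Proof.
elim: w => [|i w IHw]; first exact: weyl_refl.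
rewrite rev_cons -cats1 catA; apply: weyl_trans (weyl_square i).
by have := weyl_ctx [:: i] [:: i] IHw; rewrite -!catA.
Qed.

Lemma weyl_inverse v w : weyl_eq (v ++ w) [::] -> weyl_eq v (rev w).
Proof.
move=> vw; apply: (@weyl_trans _ (v ++ w ++ rev w)).
  rewrite -[X in weyl_eq X _]cats0; apply: weyl_cat; first exact: weyl_refl.
  exact/weyl_sym/weyl_cat_rev.
by rewrite catA; apply: (weyl_cat vw (weyl_refl _)).
Qed.

Lemma weyl_swap i j : i != j -> ~~ adjacent i j -> weyl_eq [:: i; j] [:: j; i].
Proof.
by move=> ij nij; apply: (@weyl_inverse [:: i; j] [:: i; j]); apply: weyl_commute.
Qed.

Lemma weyl_braid3 i j : adjacent i j -> weyl_eq [:: i; j; i] [:: j; i; j].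
Proof.
by move=> ij; apply: (@weyl_inverse [:: i; j; i] [:: j; i; j]); apply: weyl_braid.
Qed.

Definition simple_root i : 'rV[int]_7 := delta_mx 0 i.

(** Minus the pairing of b with the i-th simple coroot. *)
Definition minus_coroot i (b : 'rV[int]_7) : int :=
  - (b 0 i *+ 2) + \sum_(j | adjacent i j) b 0 j.

Definition root_refl i (b : 'rV[int]_7) : 'rV[int]_7 :=
  b + minus_coroot i b *: simple_root i.

Definition root_act w b := foldr root_refl b w.

Lemma adjacentC i j : adjacent i j = adjacent j i.
Proof. by rewrite /adjacent orbC. Qed.

Lemma adjacent_irr i : ~~ adjacent i i.
Proof. by case: i => -[|[|[|[|[|[|[|//]]]]]]]. Qed.

Lemma minus_corootD i b c :
  minus_coroot i (b + c) = minus_coroot i b + minus_coroot i c.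
Proof.
rewrite /minus_coroot !mxE mulrnDl opprD addrACA; congr (_ + _).
by rewrite -big_split; apply: eq_bigr => j _; rewrite mxE.
Qed.

Lemma minus_corootZ i (z : int) b : minus_coroot i (z *: b) = z * minus_coroot i b.
Proof.
rewrite /minus_coroot !mxE mulrDr mulrN mulrnAr; congr (_ + _).
by rewrite mulr_sumr; apply: eq_bigr => j _; rewrite mxE.
Qed.

Lemma minus_coroot_root i j :
  minus_coroot i (simple_root j) = if i == j then - 2%:R else (adjacent i j)%:R.
Proof.
have sumE : \sum_(k | adjacent i k) simple_root j 0 k = (adjacent i j)%:R.
  have [ij|ij] := boolP (adjacent i j).
    rewrite (bigD1 j) //= mxE !eqxx big1 ?addr0 // => k /andP[_ kj].
    by rewrite mxE (negPf kj) andbF.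
  rewrite big1 // => k ik; rewrite mxE eqxx; case: eqP => // kj.
  by rewrite -kj ik in ij.
rewrite /minus_coroot sumE mxE eqxx /=; case: eqP => [->|_].
  by rewrite (negPf (adjacent_irr j)) addr0.
by rewrite mul0rn oppr0 add0r.
Qed.

Lemma root_reflK i b : root_refl i (root_refl i b) = b.
Proof.
rewrite /root_refl minus_corootD minus_corootZ minus_coroot_root eqxx.
by apply/rowP => k; rewrite !mxE; ring.
Qed.

Lemma root_refl_self i : root_refl i (simple_root i) = - simple_root i.
Proof.
by rewrite /root_refl minus_coroot_root eqxx; apply/rowP => k; rewrite !mxE; ring.
Qed.

Lemma root_refl_commute i j b : i != j -> ~~ adjacent i j ->
  root_refl i (root_refl j b) = root_refl j (root_refl i b).
Proof.
move=> ij nij; have ji : (j == i) = false by rewrite eq_sym (negPf ij).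
have nji : ~~ adjacent j i by rewrite adjacentC.
rewrite /root_refl !(minus_corootD, minus_corootZ, minus_coroot_root).
rewrite ji (negPf ij) (negPf nij) (negPf nji).
by rewrite !mulr0 !addr0 addrAC.
Qed.

Lemma root_refl_braid i j b : adjacent i j ->
  root_refl i (root_refl j (root_refl i b)) =
  root_refl j (root_refl i (root_refl j b)).
Proof.
move=> ij; have nij : (i == j) = false.
  by apply/eqP => E; rewrite E (negPf (adjacent_irr j)) in ij.
have nji : (j == i) = false by rewrite eq_sym.
have ji : adjacent j i by rewrite adjacentC.
rewrite /root_refl !(minus_corootD, minus_corootZ, minus_coroot_root).
rewrite !eqxx nij nji ij ji /=.
by apply/rowP => k; rewrite !mxE; ring.
Qed.

Lemma root_act_cat v w b : root_act (v ++ w) b = root_act v (root_act w b).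
Proof. by rewrite /root_act foldr_cat. Qed.

Lemma root_act_weyl v w : weyl_eq v w -> root_act v =1 root_act w.
Proof.
elim=> {v w} [w|v w _ IH|u v w _ IHu _ IHv|x y v w _ IH|i|i j ij nij|i j ij] b //.
- by rewrite IHu.
- by rewrite !root_act_cat IH.
- exact: root_reflK.
- by rewrite /= (root_refl_commute _ ij nij) !root_reflK.
- by rewrite /= (root_refl_braid _ ij) !root_reflK.
Qed.

Lemma root_actD w b c : root_act w (b + c) = root_act w b + root_act w c.
Proof.
elim: w => //= i w ->; rewrite /root_refl minus_corootD scalerDl.
by rewrite addrACA.
Qed.

Lemma root_actN w b : root_act w (- b) = - root_act w b.
Proof.
elim: w => //= i w ->; rewrite /root_refl -[in minus_coroot _ _]scaleN1r minus_corootZ.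
by rewrite mulN1r scaleNr opprD.
Qed.

Definition positive (b : 'rV[int]_7) := forall j, 0 <= b 0 j.

(** Induction on the length of w = w' s_j. For i adjacent to j, the root of i
    goes to w'(root i) + w'(root j). By the induction hypothesis for w' at i and
    at j, this is positive, or w' s_j is shorter than w', in which case the word
    w s_i is at most as long as w', or w' = u s_i with u shorter. In the last
    case w(root i) = u(root j), and the induction hypothesis for u at j concludes
    with the braid relation. *)
Lemma positive_or_shorter w i :
  positive (root_act w (simple_root i)) \/
  exists u, (size u < size w)%N /\ weyl_eq (w ++ [:: i]) u.
Proof.
have [n] := ubnP (size w); elim: n w i => // n IHn w i.
case/lastP: w => [_|w j]; first by left=> j; rewrite mxE; case: andP.
rewrite size_rcons ltnS => wn; rewrite -cats1 root_act_cat /=.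
have [->|ij] := eqVneq i j.
  right; exists w; split=> //; rewrite -catA -[X in weyl_eq _ X]cats0.
  by apply: weyl_cat; [apply: weyl_refl | apply: weyl_square].
have {}wn : (size w < n)%N by [].
have [aij|nij] := boolP (adjacent i j); last first.
  have -> : root_refl j (simple_root i) = simple_root i.
    rewrite /root_refl minus_coroot_root eq_sym (negPf ij) adjacentC (negPf nij).
    by rewrite scale0r addr0.
  have [|[u [uw wu]]] := IHn w i wn; first by left.
  right; exists (u ++ [:: j]); rewrite size_cat addn1 ltnS; split=> //.
  apply: weyl_trans (weyl_cat wu (weyl_refl [:: j])); rewrite -!catA.
  by apply: weyl_cat; [apply: weyl_refl | apply/weyl_sym/weyl_swap].
have -> : root_refl j (simple_root i) = simple_root i + simple_root j.
  by rewrite /root_refl minus_coroot_root eq_sym (negPf ij) adjacentC aij scale1r.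
have [wi|[u [uw wu]]] := IHn w i wn.
  have [wj|[u [uw wu]]] := IHn w j wn.
    by left=> k; rewrite root_actD mxE addr_ge0.
  right; exists (u ++ [:: i]); rewrite size_cat addn1 ltnS; split=> //.
  exact: weyl_cat wu (weyl_refl _).
have wE : weyl_eq w (u ++ [:: i]).
  rewrite -[w]cats0.
  apply: weyl_trans (weyl_cat (weyl_refl w) (weyl_sym (weyl_square i))) _.
  by rewrite (catA w [:: i] [:: i]); apply: weyl_cat wu (weyl_refl _).
have -> : root_act w (simple_root i + simple_root j) = root_act u (simple_root j).
  rewrite (root_act_weyl wE) root_act_cat /=; congr (root_act u _).
  rewrite /root_refl minus_corootD !minus_coroot_root eqxx (negPf ij) aij /=.
  by apply/rowP => k; rewrite !mxE; ring.
have [|[u' [u'u uu']]] := IHn u j (ltn_trans uw wn); first by left.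
right; exists (u' ++ [:: i; j]); split.
  by rewrite size_cat /=; lia.
apply: (@weyl_trans _ (u ++ [:: i; j; i])).
  by rewrite -catA; have := weyl_cat wE (weyl_refl [:: j; i]); rewrite -catA.
apply: (@weyl_trans _ (u ++ [:: j; i; j])).
  by apply: weyl_cat; [apply: weyl_refl | apply: weyl_braid3].
by have := weyl_cat uu' (weyl_refl [:: i; j]); rewrite -catA.
Qed.

(** If w = w' s_j fixes the root of j, then w' sends it to its opposite, so w has
    a shorter expression, which acts trivially as well. *)
Lemma root_act_faithful w : (forall b, root_act w b = b) -> weyl_eq w [::].
Proof.
have [n] := ubnP (size w); elim: n w => // n IHn w.
case/lastP: w => [_ _|w j]; first exact: weyl_refl.
rewrite size_rcons ltnS -cats1 => wn fixw.
have [wj|[u [uw wu]]] := positive_or_shorter w j.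
  have := fixw (simple_root j); rewrite root_act_cat /= root_refl_self root_actN.
  move/(congr1 (fun b : 'rV[int]_7 => b 0 j)); move: (wj j).
  by rewrite !mxE !eqxx /=; lia.
apply: (weyl_trans wu); apply: (IHn _ (ltn_trans uw wn)) => b.
by rewrite -(root_act_weyl wu) fixw.
Qed.

End WeylWords.

(** * Words acting by Baecklund transformations *)

Section Actions.
Variable C : numFieldType.
Local Notation K := (ratfun C).
Implicit Types (al be : 7.-tuple C) (v w : seq 'I_7).
Local Notation act w := (composite (map (sgen C) w)).

Definition pairing (b : 'rV[int]_7) al : C := \sum_(j < 7) (b 0 j)%:~R * al`_j.

(** Reflections of parameters are transposes of reflections of roots. *)
Lemma pairing_reflect b (k : 'I_7) al be : be = reflect_params k al :> seq C ->
  pairing b be = pairing (root_refl k b) al.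
Proof.
move=> beE; rewrite /pairing beE.
have reflE (j : 'I_7) : (reflect_params k al)`_j =
    al`_j + ((adjacent k j)%:R - (j == k)%:R *+ 2) * al`_k.
  have [->|jk] := eqVneq j k.
    by rewrite reflect_self // (negPf (adjacent_irr k)) /=; ring.
  rewrite reflect_other // -[adj k j]/(adjacent k j).
  by case: (adjacent k j) => /=; ring.
have pickk (f : 'I_7 -> C) : \sum_j f j * (j == k)%:R = f k.
  rewrite (bigD1 k) //= eqxx mulr1 big1 ?addr0 // => j /negPf->.
  by rewrite mulr0.
have coefE : (minus_coroot k b)%:~R =
    \sum_j (b 0 j)%:~R * ((adjacent k j)%:R - (j == k)%:R *+ 2) :> C.
  rewrite /minus_coroot rmorphD rmorphN rmorphMn rmorph_sum /= addrC big_mkcond /=.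
  rewrite -(pickk (fun j => (b 0 j)%:~R)) -sumrMnl -sumrB.
  by apply: eq_bigr => j _; case: (adjacent k j); case: (j == k) => /=; ring.
transitivity (\sum_j (b 0 j)%:~R * al`_j + (minus_coroot k b)%:~R * al`_k).
  rewrite coefE mulr_suml -big_split; apply: eq_bigr => j _ /=.
  by rewrite reflE mulrDr mulrA.
rewrite -(pickk (fun j => (minus_coroot k b)%:~R * al`_j)) -big_split.
apply: eq_bigr => j _ /=.
have -> : root_refl k b 0 j = if j == k then b 0 j + minus_coroot k b else b 0 j.
  by rewrite !mxE eqxx /=; case: (j == k) => /=; rewrite ?mulr1 ?mulr0 ?addr0.
by case: (j == k) => /=; rewrite ?intrD; ring.
Qed.

Lemma pairing_act w b al : pairing b (act w al).2 = pairing (root_act w b) al.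
Proof.
elim: w al b => //= k w IHw al b.
by rewrite comptE IHw (pairing_reflect _ (sgen_params k al)).
Qed.

Lemma pairingB b c al : pairing (b - c) al = pairing b al - pairing c al.
Proof.
by rewrite /pairing -sumrB; apply: eq_bigr => j _; rewrite !mxE intrB mulrBl.
Qed.

(** The normalized parameters span the whole space: the multiples of basis vectors
    by the inverses of the coefficients 1, 1, 2, 2, 2, 1, 1 are normalized. *)
Lemma pairing_eq0 b : (forall al, normalized al -> pairing b al = 0) -> b = 0.
Proof.
move=> b0; apply/rowP => i; rewrite mxE.
have two0 : 2 != 0 :> C by rewrite pnatr_eq0.
pose m : C := nth 0 [:: 1; 1; 2; 2; 2; 1; 1] i.
have m0 : m != 0.
  by rewrite /m; case: (i) => [[|[|[|[|[|[|[|//]]]]]]] i7]; rewrite /= ?oner_neq0.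
pose al := [tuple (if j == i then m^-1 else 0) | j < 7].
have alE k : (k < 7)%N -> al`_k = if k == i then m^-1 else 0.
  by move=> k7; rewrite (nth_mktuple _ 0 (Ordinal k7)).
have al1 : normalized al.
  rewrite /normalized !alE //; rewrite /m {alE al m m0}.
  by case: i => [[|[|[|[|[|[|[|//]]]]]]] i7] /=; field.
have := b0 _ al1; rewrite /pairing (bigD1 i) //= big1 ?addr0 => [|j ji]; last first.
  by rewrite alE // -[_ == _ :> nat]/(j == i) (negPf ji) mulr0.
rewrite alE // eqxx => /eqP.
by rewrite mulf_eq0 invr_eq0 (negPf m0) orbF intr_eq0 => /eqP.
Qed.

Lemma admissible_sgen k : admissible (sgen C k).
Proof. by case: (sgen_symmetries C k) => [[]]. Qed.

Lemma admissible_act w : admissible (act w).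
Proof.
elim: w => [|k w IHw]; first exact: admissible_id.
exact: admissible_comp (@admissible_sgen k) IHw.
Qed.

Lemma eqt_act_weyl v w : eqt (act v) (act w) -> weyl_eq v w.
Proof.
move=> vw; rewrite -[w]revK; apply: weyl_inverse; apply: root_act_faithful => b.
have E c : root_act v c = root_act w c.
  apply/eqP; rewrite -subr_eq0; apply/eqP/pairing_eq0 => al nal.
  by rewrite pairingB -!pairing_act vw ?subrr.
by rewrite root_act_cat E -root_act_cat (root_act_weyl (weyl_cat_rev w)).
Qed.

Lemma act_cat v w : eqt (act (v ++ w)) (compt (act v) (act w)).
Proof.
elim: v => [|k v IHv] /=; first exact/eqt_sym/compt_idl.
apply: eqt_trans (eqt_compt (@admissible_sgen k) (@eqt_refl _ _) IHv) _.
exact: comptA (@admissible_sgen k) (@admissible_act v).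
Qed.

Lemma act_ctx x y v w : eqt (act v) (act w) ->
  eqt (act (x ++ v ++ y)) (act (x ++ w ++ y)).
Proof.
have E u : eqt (act (x ++ u ++ y)) (compt (act x) (compt (act u) (act y))).
  apply: eqt_trans (act_cat _ _) _; apply: eqt_compt (@eqt_refl _ _) (act_cat _ _).
  exact: admissible_act.
move=> vw; apply: eqt_trans (E v) _; apply: eqt_trans (eqt_sym (E w)).
apply: eqt_compt (@eqt_refl _ _) _; first exact: admissible_act.
by apply: eqt_compt vw (@eqt_refl _ _); apply: admissible_act.
Qed.

Lemma act_square k : eqt (act [:: k; k]) (act [::]).
Proof.
have [_ _ kk _] := sgen_symmetries C k; apply: eqt_trans _ kk.
apply: eqt_compt (@eqt_refl _ _) _; first exact: admissible_sgen.
exact/compt_idr/admissible_sgen.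
Qed.

(** The action of a word computed on points: start from the generic point and
    apply the shears successively. *)
Definition walk w al :=
  foldl (fun z k => step k z) (coords C : seq K, csts al) (map val w).

(** The mirrors do not vanish at the point F, being images of nonzero functions
    under the field morphism subst F. *)
Lemma mirror_dominant (F : 6.-tuple K) k : dominant F -> (k < 7)%N -> mirror k F != 0.
Proof.
move=> domF k7; rewrite -(subst_unique domF (value_mirror (value_coords F) k)).
exact: subst_neq0 domF (mirror_coords C k7).
Qed.

Lemma act_rcons w k : eqt (act (rcons w k)) (compt (act w) (sgen C k)).
Proof.
rewrite -cats1; apply: eqt_trans (act_cat _ _) _.
apply: eqt_compt (@eqt_refl _ _) _; first exact: admissible_act.
exact/compt_idr/admissible_sgen.
Qed.

Lemma act_walk w al : normalized al ->
  ((act w al).1 : seq K, csts (act w al).2) = walk w al.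
Proof.
elim/last_ind: w al => [|w k IHw] al nal //.
rewrite (act_rcons _ _ nal) comptE /walk map_rcons foldl_rcons -/(walk w al) -IHw //.
have [_ domF] := admissible_act w nal.
move: (act w al).1 (act w al).2 domF => F be domF; rewrite csts_sgen.
congr pair; apply: (@eq_from_nth _ 0); first by rewrite size_tuple size_mkseq.
move=> i; rewrite size_tuple => i6; rewrite -(tnth_nth 0 _ (Ordinal i6)) tnth_map.
apply: (subst_unique domF); rewrite (tnth_nth 0) sgen_map.
apply: value_shear; [exact: value_coords | exact: value_csts |].
exact: mirror_dominant.
Qed.

Lemma walk_eq v w : (forall al, normalized al -> walk v al = walk w al) ->
  eqt (act v) (act w).
Proof.
move=> vw al nal; have := vw al nal; rewrite -!act_walk //.
case: (act v al) (act w al) => [F be] [G ga] /= [FG bega].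
congr pair; apply: val_inj => //; apply: inj_map bega.
exact: fmorph_inj.
Qed.

Lemma mirror_walk w al k : normalized al -> (k < 7)%N -> mirror k (walk w al).1 != 0.
Proof.
move=> nal k7; rewrite -act_walk //; apply: mirror_dominant => //.
by have [] := admissible_act w nal.
Qed.

Lemma act_swap i j : i != j -> ~~ adjacent i j -> eqt (act [:: i; j]) (act [:: j; i]).
Proof.
move=> ij nij; apply: walk_eq => al _; rewrite /walk /=.
by apply: step_commute; rewrite ?adjacentC // 1?eq_sym // adjC.
Qed.

Lemma act_braid i j : adjacent i j -> eqt (act [:: i; j; i]) (act [:: j; i; j]).
Proof.
move=> ij; apply: walk_eq => al nal; apply: (step_braid (ltn_ord i) (ltn_ord j) ij).
- by apply/eqP => /val_inj E; rewrite E (negPf (adjacent_irr j)) in ij.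
- exact: (mirror_walk [::]).
- exact: (mirror_walk [::]).
- exact: (mirror_walk [:: i]).
- exact: (mirror_walk [:: j]).
Qed.

Lemma weyl_eqt_act v w : weyl_eq v w -> eqt (act v) (act w).
Proof.
elim=> {v w} [w|v w _ IH|u v w _ IHu _ IHv|x y v w _ IH|i|i j ij nij|i j ij].
- exact: eqt_refl.
- exact: eqt_sym.
- exact: eqt_trans IHv.
- exact: act_ctx.
- exact: act_square.
- apply: eqt_trans (act_ctx [::] [:: i; j] (act_swap ij nij)) _.
  apply: eqt_trans (act_ctx [:: j] [:: j] (act_square i)) _.
  exact: act_square.
- apply: eqt_trans (act_ctx [::] [:: j; i; j] (act_braid ij)) _.
  apply: eqt_trans (act_ctx [:: j; i] [:: i; j] (act_square j)) _.
  apply: eqt_trans (act_ctx [:: j] [:: j] (act_square i)) _.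
  exact: act_square.
Qed.

End Actions.

Theorem mainTheorem2 (R : realType) :
  [/\ forall k : 'I_7, backlund (sgen R[i] k),
      forall k : 'I_3, backlund (pigen R[i] k),
      forall w : seq ('I_7 + 'I_3), backlund (composite (map (gen R[i]) w))
    & forall v w : seq 'I_7,
        eqt (composite (map (sgen R[i]) v)) (composite (map (sgen R[i]) w))
        <-> weyl_eq v w].
Proof.
split=> [k|k|w|v w].
- exact: inverse_symmetries_backlund (sgen_symmetries R[i] k).
- have [g gP] := pigen_symmetries R[i] k.
  exact: inverse_symmetries_backlund gP.
- have [x|g gP] := @composite_symmetries R[i] _ (gen R[i]) w.
    case: x => k; last exact: pigen_symmetries.
    by exists (sgen R[i] k); apply: sgen_symmetries.
  exact: inverse_symmetries_backlund gP.
- by split; [apply: eqt_act_weyl | apply: weyl_eqt_act].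
Qed.
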